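(* Let $G$ be a non-elementary hyperbolic group acting by isometries, properly and cocompactly, on a connected graph $\Upsilon$. Let $H \subset G$ be a quasiconvex subgroup of infinite index. Then $$\lambda_H(\Upsilon) < \lambda_G(\Upsilon).$$
   Context: Hyperbolic means (word-)hyperbolic in the sense of Gromov; quasiconvex subgroups are quasiconvex in a Cayley graph of $G$ with respect to a finite generating set. A group is elementary if it contains a cyclic subgroup of finite index, and non-elementary otherwise. The graph $\Upsilon$ carries its graph metric $d_\Upsilon$ (edges have length $1$). The action is proper if for every vertex $b$ and every $r \ge 0$ the set $\{g\in G : d_\Upsilon(b,gb)\le r\}$ is finite, and cocompact if there are finitely many $G$-orbits of vertices and edges. Growth rates: fix a basepoint $b\in\Upsilon$. For a subset $H\subset G$ let $$f_{H,\Upsilon}(n) = \#\{h\in H : d_\Upsilon(b,h(b))\le n\}, \qquad \lambda_H(\Upsilon) = \limsup_{n\to\infty} \sqrt[n]{f_{H,\Upsilon}(n)}.$$ The number $\lambda_H(\Upsilon)$ does not depend on $b$. *)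

(* Defs.v *)
From HB Require Import structures.
From mathcomp Require Import all_boot all_order all_algebra finmap.
From mathcomp Require Import all_classical all_reals all_analysis.

Set Implicit Arguments.
Unset Strict Implicit.
Unset Printing Implicit Defensive.
Import Order.TTheory GRing.Theory Num.Theory.
Local Open Scope classical_set_scope.
Local Open Scope ring_scope.

(* Graphs in the sense of Serre, so loops and multiple edges are allowed: a
   dart is an oriented edge, and the (unoriented) edges are the pairs
   {e, rev e}. *)
Record graph := Graph {
  vertex :> Type;
  dart : Type;
  src : dart -> vertex;
  rev_dart : dart -> dart;
  rev_dartK : involutive rev_dart;
  rev_dart_neq : forall e, rev_dart e <> e }.

Definition tgt (X : graph) (e : dart X) : X := src (rev_dart e).

Fixpoint walk (X : graph) (u : X) (s : seq (dart X)) (v : X) : Prop :=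
  if s is e :: s' then src e = u /\ walk (tgt e) s' v else u = v.

Definition connected_graph (X : graph) := forall u v : X, exists s, walk u s v.

(* Graph metric: the least length of a walk (0 if there is none). *)
Definition gdist (X : graph) (u v : X) : nat :=
  xget 0%N [set n | (exists2 s, walk u s v & size s = n) /\
                    (forall t, walk u t v -> (n <= size t)%N)].

Definition geodesic (X : graph) (u : X) (s : seq (dart X)) (v : X) :=
  walk u s v /\ size s = gdist u v.

(* Points in the interior of an edge are within 1/2 of a vertex, so that it
   suffices to bound the distance to Y from the vertices of the geodesics. *)
Definition quasiconvex (X : graph) (Y : set X) :=
  exists K : nat, forall x y s, Y x -> Y y -> geodesic x s y ->
    forall s1 s2 z, s = s1 ++ s2 -> walk x s1 z ->
      exists2 h, Y h & (gdist z h <= K)%N.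

Section GromovHyperbolicity.
Variables (R : realType) (X : Type) (d : X -> X -> R).

Definition gromov_product (w x y : X) : R := (d x w + d y w - d x y) / 2.

Definition gromov_hyperbolic := exists delta : R, forall w x y z,
  Num.min (gromov_product w x y) (gromov_product w y z) - delta
    <= gromov_product w x z.

End GromovHyperbolicity.

Section Groups.
Variable G : groupType.
Implicit Types H S : set G.

Definition is_subgroup H := group_closed (mem H).

Definition generated S : set G := smallest is_subgroup S.

Definition left_cosets H : set (set G) :=
  range (fun g : G => [set (g * h)%g | h in H]).

Definition finite_index H := finite_set (left_cosets H).

Definition elementary_group := exists x : G, finite_index (generated [set x]).

Section CayleyGraph.
Variable S : set G.

(* The darts (g, s, true) and (g, s, false) are the two orientations of the
   edge labelled by s that joins g to g * s. *)
Definition cayley_dart := (G * S * bool)%type.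

Definition cayley_src (e : cayley_dart) : G :=
  let: (g, s, o) := e in if o then g else (g * \val s)%g.

Definition cayley_rev (e : cayley_dart) : cayley_dart :=
  let: (g, s, o) := e in (g, s, ~~ o).

Lemma cayley_revK : involutive cayley_rev.
Proof. by move=> [[g s] []]. Qed.

Lemma cayley_rev_neq e : cayley_rev e <> e.
Proof. by case: e => [[g s] []]. Qed.

Definition cayley : graph :=
  @Graph G cayley_dart cayley_src cayley_rev cayley_revK cayley_rev_neq.

End CayleyGraph.

Definition finite_generating_set S := finite_set S /\ generated S = setT.

Definition word_dist S (g h : G) : nat := @gdist (cayley S) g h.

Definition hyperbolic_group (R : realType) := exists2 S : set G,
  finite_generating_set S &
  gromov_hyperbolic (fun g h : G => (word_dist S g h)%:R : R).

Definition quasiconvex_subgroup H := is_subgroup H /\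
  exists2 S : set G, finite_generating_set S & @quasiconvex (cayley S) H.

End Groups.

(* Left actions by graph automorphisms; edge inversions are allowed. *)
Record graph_action (G : groupType) (X : graph) := GraphAction {
  actv :> G -> X -> X;
  actd : G -> dart X -> dart X;
  actv1 : forall x, actv 1%g x = x;
  actvM : forall g h x, actv (g * h)%g x = actv g (actv h x);
  actd1 : forall e, actd 1%g e = e;
  actdM : forall g h e, actd (g * h)%g e = actd g (actd h e);
  act_src : forall g e, src (actd g e) = actv g (src e);
  act_rev : forall g e, rev_dart (actd g e) = actd g (rev_dart e) }.

Section Actions.
Variables (G : groupType) (X : graph) (a : graph_action G X).

Lemma walk_act g u s v : walk u s v -> walk (a g u) (map (actd a g) s) (a g v).
Proof.
elim: s u => [|e s IH] u /=; first by move=> ->.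
by move=> [<- /IH]; rewrite /tgt act_src act_rev act_src.
Qed.

Lemma gdist_act g u v : gdist (a g u) (a g v) = gdist u v.
Proof.
have actK h w : a (h^-1)%g (a h w) = w by rewrite -actvM mulVg actv1.
congr xget; apply/seteqP; split=> n [[s sw <-] nmin]; split.
- exists (map (actd a (g^-1)%g) s); last by rewrite size_map.
  by move/(walk_act (g^-1)%g): sw; rewrite !actK.
- by move=> t /(walk_act g)/nmin; rewrite size_map.
- by exists (map (actd a g) s); [exact: walk_act | rewrite size_map].
- by move=> t /(walk_act (g^-1)%g); rewrite !actK => /nmin; rewrite size_map.
Qed.

Definition proper_action := forall (b : X) (r : nat),
  finite_set [set g | (gdist b (a g b) <= r)%N].

(* Each edge consists of two darts, so there are finitely many orbits of edges
   if and only if there are finitely many orbits of darts. *)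
Definition cocompact_action :=
  finite_set (range (fun v : X => range (fun g => a g v))) /\
  finite_set (range (fun e : dart X => range (fun g => actd a g e))).

(* fset_set is meaningful on finite sets only, which properness ensures. *)
Definition growth_function (b : X) (H : set G) (n : nat) : nat :=
  #|` fset_set [set h | H h /\ (gdist b (a h b) <= n)%N]|.

Definition growth_rate (R : realType) (b : X) (H : set G) : \bar R :=
  limn_esup (fun n => ((growth_function b H n)%:R `^ (n%:R^-1))%:E).

End Actions.

(* Main.v *)
Require Import Defs.
From HB Require Import structures.
From mathcomp Require Import all_boot all_order all_algebra finmap.
From mathcomp Require Import all_classical all_reals all_analysis.
From mathcomp Require Import zify ring lra.

(** The growth of H is strictly smaller because H together with one well chosen
element g of G produces too many elements.  Suppose that g is long and points
away from H in both directions: the Gromov products at 1 of g and of g^-1 with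
the elements of H are bounded by a constant independent of the length of g.
Then a product  g a_1 g a_2 g ... a_k g  with long factors a_i in H follows a
quasi-geodesic, and it can be decoded from left to right, each a_i being known
up to a fixed number N of possibilities ([coded_products]).  Let l(x) = d(b, x b), and give x the
weight theta^l(x).  As soon as a finite set A of long elements of H satisfies
theta^l(g) * sum_(a in A) theta^l(a) >= N, multiplying a set of such products
on the left by all the g a, with a in A, does not decrease its total weight
([words_weight]).  So arbitrarily long elements of G carry a total weight that
is bounded below, and this forces the growth rate of G to be at least
theta^-1 ([coded_growth]).  A theta slightly smaller than 1/lambda_H can be
used because the series sum_(h in H) theta^l(h) diverges at
theta = 1/lambda_H.

Divergence is where quasiconvexity matters.  A geodesic of the graph from b to
h b stays close to the orbit H b, so h can be cut at any intermediate length
into two elements of H ([split_quasiconvex]); hence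
f_H(n + m) <= B f_H(n) f_H(m) ([cnt_submultiplicative]), hence
lambda_H^n <= B f_H(n) for all n ([submultiplicative_rate]), and the series
diverges ([poincare_diverges]).  The closeness comes from the stability of
quasi-geodesics in hyperbolic spaces, applied to the geodesics of the graph and
of the two Cayley graphs involved, all seen in the hyperbolic word metric.

The element g is obtained in two steps.  Infinite index provides a long u that
is shortest in its coset H u, and such a u has bounded Gromov products with H
([shortest_in_coset]).  Then g = u t u^-1, where t is long and neither t nor
t^-1 follows u^-1 ([exists_transverse]).  That such a t exists for any given
u is where G being non-elementary matters: finiteness of the number of cone
types gives an element v all of whose powers are geodesic, some c moves the
axis of v away from itself, and no u^-1 can follow both the axis of v and its
translate by c ([transverse_long_elements]).

The series diverges for infinite H only; a finite H is compared with the
subgroup generated by v, which is infinite and again quasiconvex of infinite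
index.

Distances are natural numbers.  To stay inside them, Gromov products are
doubled, and the hyperbolicity constant e stands for 2 delta. *)

Set Implicit Arguments.
Unset Strict Implicit.
Unset Printing Implicit Defensive.
Import Order.TTheory GRing.Theory Num.Theory.
Local Open Scope classical_set_scope.
Local Open Scope nat_scope.

(** * Hyperbolic metrics and stability of quasi-geodesics *)

Record geodesic_metric (T : Type) (d : T -> T -> nat) : Prop :=
  GeodesicMetric {
    dist_xx : forall x, d x x = 0;
    dist_eq0 : forall x y, d x y = 0 -> x = y;
    distC : forall x y, d x y = d y x;
    dist_tri : forall y x z, d x z <= d x y + d y z;
    dist_split : forall x y k, k <= d x y ->
      exists2 z, d x z = k & d x z + d z y = d x y }.

(** The four-point condition, stated on sums of distances rather than on Gromov
    products. *)
Record hyperbolic_metric (T : Type) (d : T -> T -> nat) (e : nat) : Prop :=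
  HyperbolicMetric {
    hyperbolic_geodesic :> geodesic_metric d;
    dist_four : forall w x y z,
      d x z + d y w <= maxn (d x y + d z w) (d y z + d x w) + e }.

Lemma geodesic_path (T : Type) (d : T -> T -> nat) n x y :
  geodesic_metric d -> d x y = n -> exists p : nat -> T,
  [/\ p 0 = x, p n = y & forall i j, i <= j <= n -> d (p i) (p j) = j - i].
Proof.
move=> hd; elim: n y => [|n IH] y dxy.
  exists (fun=> x); split=> // [|i j ijn]; first exact: (dist_eq0 hd).
  by rewrite (dist_xx hd); lia.
have [z dxz dzy] : exists2 z, d x z = n & d x z + d z y = d x y.
  by apply: (dist_split hd); lia.
have [p [p0 pn dp]] := IH z dxz.
exists (fun i => if i <= n then p i else y); split => [||i j /andP[ij jn]].
- by rewrite p0.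
- by rewrite ltnn.
have [ltjn|ltnj] := leqP j n; first by rewrite (leq_trans ij ltjn) dp ?ij.
have -> : j = n.+1 by lia.
have [lein|] := leqP i n; last by rewrite (dist_xx hd); lia.
have := dp i n; rewrite lein leqnn pn => /(_ isT) dpi.
have := dp 0 i; rewrite p0 lein => /(_ isT) dxi.
have := dist_tri hd z (p i) y; have := dist_tri hd (p i) x y; lia.
Qed.

Section HyperbolicMetric.
Variables (T : Type) (d : T -> T -> nat) (e : nat).
Hypothesis hd : hyperbolic_metric d e.

(** Twice the Gromov product of x and y at w.  The triangle inequality keeps the
    truncated subtraction exact ([gromov2E]). *)
Definition gromov2 w x y := d x w + d y w - d x y.

Definition between x z y := d x z + d z y = d x y.

Lemma gromov2E w x y : gromov2 w x y + d x y = d x w + d y w.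
Proof. by rewrite /gromov2; have := dist_tri hd w x y; rewrite (distC hd w y); lia. Qed.

Lemma gromov2C w x y : gromov2 w x y = gromov2 w y x.
Proof. by rewrite /gromov2 (distC hd x y); lia. Qed.

Lemma gromov2_xx w x : gromov2 w x x = (d x w).*2.
Proof. by rewrite /gromov2 (dist_xx hd); lia. Qed.

Lemma gromov2_le w x y : gromov2 w x y <= (d x w).*2.
Proof.
by have := gromov2E w x y; have := dist_tri hd x y w; rewrite (distC hd y x); lia.
Qed.

Lemma gromov2_four w x y z : minn (gromov2 w x y) (gromov2 w y z) <= gromov2 w x z + e.
Proof.
have := dist_four hd w x y z.
by have := gromov2E w x y; have := gromov2E w y z; have := gromov2E w x z; lia.
Qed.

Lemma gromov2_lip w x y y' : gromov2 w x y <= gromov2 w x y' + (d y y').*2.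
Proof.
have := gromov2E w x y; have := gromov2E w x y'.
have := dist_tri hd y' y w; have := dist_tri hd y x y'; lia.
Qed.

(** This converts an upper bound at one end of a segment into a lower bound at its
    other end: two paths that separate early as seen from x run together for a
    long time as seen from w. *)
Lemma gromov2_swap w x y : gromov2 w x y + gromov2 x w y = (d x w).*2.
Proof.
have := gromov2E w x y; have := gromov2E x w y.
rewrite (distC hd y w) (distC hd y x) (distC hd w x); lia.
Qed.

(** Almost geodesic paths with the same ends fellow-travel: the position of a point
    is determined, up to a constant, by its distance to p. *)
Lemma near_geodesic_close p q x y a b :
  d p x + d x q <= d p q + a -> d p y + d y q <= d p q + b ->
  d x y <= maxn (d p x - d p y + b) (d p y - d p x + a) + e.
Proof.
have := dist_four hd q x p y.
have := distC hd p x; have := distC hd p y; lia.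
Qed.

Lemma between_trans x y z w : between x w y -> between w z y -> between x z y.
Proof.
rewrite /between => xwy wzy.
have := dist_tri hd z x y; have := dist_tri hd w x z; lia.
Qed.

Lemma between_mid x y z w : between x w y -> between w z y -> between x w z.
Proof.
rewrite /between => xwy wzy.
have := dist_tri hd z x y; have := dist_tri hd w x z; lia.
Qed.

Lemma betweenC x y z : between x z y -> between y z x.
Proof. by rewrite /between (distC hd y z) (distC hd z x) (distC hd y x); lia. Qed.

Lemma gromov2_between w x y : between x w y -> gromov2 w x y = 0.
Proof. by rewrite /between (distC hd w y) => h; have := gromov2E w x y; lia. Qed.

(** Cutting the path in its middle costs e once, so k halvings are enough for
    2 ^ k steps: the loss is logarithmic in the number of steps. *)
Lemma gromov2_chain w r k (p : nat -> T) i j : i < j <= i + 2 ^ k ->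
  (forall l, i <= l < j -> r <= gromov2 w (p l) (p l.+1)) ->
  r <= gromov2 w (p i) (p j) + k * e.
Proof.
elim: k i j => [|k IH] i j ij hr.
  have -> : j = i.+1 by lia.
  by apply: leq_trans (hr i _) _; lia.
have [jk|kj] := leqP j (i + 2 ^ k).
  by apply: leq_trans (IH i j _ hr) _; lia.
have h2 : 0 < 2 ^ k by rewrite expn_gt0.
rewrite expnS in ij.
have h1 : r <= gromov2 w (p i) (p (i + 2 ^ k)) + k * e.
  by apply: IH => [|l lk]; [lia|apply: hr; lia].
have h3 : r <= gromov2 w (p (i + 2 ^ k)) (p j) + k * e.
  by apply: IH => [|l lk]; [lia|apply: hr; lia].
have := gromov2_four w (p i) (p (i + 2 ^ k)) (p j); lia.
Qed.

(** Only consecutive points are required to be close; the linear upper bound on all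
    distances follows ([quasi_geodesic_lip]). *)
Definition quasi_geodesic A n (p : nat -> T) :=
  (forall i, i < n -> d (p i) (p i.+1) <= A) /\
  (forall i j, i <= j <= n -> j - i <= A * (d (p i) (p j)).+1).

Lemma quasi_geodesic_lip A n p i j : quasi_geodesic A n p -> i <= j <= n ->
  d (p i) (p j) <= A * (j - i).
Proof.
case=> step _; elim: j => [|j IH] ij.
  have -> : i = 0 by lia.
  by rewrite (dist_xx hd).
have [->|ltij] := eqVneq i j.+1; first by rewrite (dist_xx hd).
have := IH; have := step j; have := dist_tri hd (p j) (p i) (p j.+1).
have -> : j.+1 - i = (j - i).+1 by lia.
rewrite mulnS; lia.
Qed.

Lemma linear_le_exp2 a b : exists k0, forall k, k0 <= k -> a * k + b <= 2 ^ k.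
Proof.
have sq k : 4 <= k -> k * k <= 2 ^ k.
  elim: k => // k IH; rewrite leq_eqVlt => /orP[/eqP <- //|k4].
  by rewrite expnS; have := IH k4; nia.
exists (4 + a + b) => k hk.
apply: leq_trans (sq k _); nia.
Qed.

(** Exponential beats linear: k halvings handle more than the A * (6 * R).+1 steps
    that a detour around a ball of radius R can have, while their cost k * e stays
    below 2 * R. *)
Lemma gap_bound A : exists R0, forall R, R0 < R ->
  exists2 k, A * (6 * R).+1 <= 2 ^ k & (k + 2) * e + A < R.*2.
Proof.
have [k0 hk] := linear_le_exp2 (6 * A * e.+1) (A * (6 * (3 * e.+1)).+1).
exists (e.+1 * (k0 + 4) + A) => R hR.
have hR2 := divn_eq R e.+1; have := ltn_pmod R (ltn0Sn e).
set q := R %/ _ in hR2 *; set m := R %% _ in hR2 * => hm.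
have hq : k0 + 4 <= q by rewrite leqNgt; apply/negP => hq; nia.
exists (q - 2); last by nia.
apply: leq_trans (hk _ _); last by lia.
have -> : q = (q - 2) + 2 by lia.
set t := q - 2.
have : R <= t * e.+1 + 3 * e.+1 by rewrite /t; nia.
nia.
Qed.

(** Let z be a point of the geodesic as far as possible from the path, at distance R
    of it.  The points w1 and w2 of the geodesic at distance 2 * R before and after
    z are still within R of the path, which joins their neighbourhoods in a number
    of steps linear in R, outside the ball of radius R around z.  By
    [gromov2_chain] the doubled product of w1 and w2 at z is then about 2 * R up to
    a logarithm of R; but it is 0 because z lies between w1 and w2. *)
Lemma geodesic_near_quasi_geodesic A : exists R, forall n p,
  quasi_geodesic A n p -> forall z, between (p 0) z (p n) ->
  exists2 i, i <= n & d z (p i) <= R.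
Proof.
have [R0 hR0] := gap_bound A; exists R0 => n p qg z0 z0b.
have [step rev] := qg.
apply: contrapT => no.
pose P r := `[< exists2 z, between (p 0) z (p n) &
                 forall i, i <= n -> r <= d z (p i) >].
have exP : exists r, P r.
  by exists 0; apply/asboolP; exists z0.
have ubP r : P r -> r <= d (p 0) (p n).
  move=> /asboolP[z zb /(_ 0 (leq0n _))].
  by rewrite (distC hd z); move: zb; rewrite /between; lia.
case: (ex_maxnP exP ubP) => R /asboolP[z zb farz] Rmax.
have R0R : R0 < R.
  apply: Rmax; apply/asboolP; exists z0 => // i lin.
  by rewrite ltnNge; apply/negP => h; apply: no; exists i.
(* No point of the geodesic is farther from the path than z. *)
have nearR w : between (p 0) w (p n) -> exists2 i, i <= n & d w (p i) <= R.
  move=> wb; apply: contrapT => far.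
  have : P R.+1.
    apply/asboolP; exists w => // i lin.
    by rewrite ltnNge; apply/negP => h; apply: far; exists i.
  by move/Rmax; rewrite ltnn.
have [k hk1 hk2] := hR0 R R0R.
(* The same construction provides w1 with q = 0, and w2 with q = n.  If that end
   of the geodesic is within 2 * R of z, it is chosen itself. *)
have side q : (q = 0 \/ q = n) -> exists2 w, between (p q) w z & exists2 i, i <= n &
    [/\ R.*2 <= gromov2 z w (p i), d w (p i) <= R & d w z <= R.*2].
  move=> qE; have [le2|gt2] := leqP (d z (p q)) R.*2.
    exists (p q); first by rewrite /between (dist_xx hd).
    exists q; first by case: qE => ->.
    rewrite gromov2_xx (dist_xx hd) (distC hd (p q)); split=> //.
    by have := farz q; case: qE => ->; lia.
  have [w dzw wb] : exists2 w, d z w = R.*2 & d z w + d w (p q) = d z (p q).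
    by apply: (dist_split hd); lia.
  have wb' : between (p 0) w (p n).
    case: qE => qE; rewrite qE in wb.
      apply: betweenC; apply: between_trans (betweenC zb) _; exact: wb.
    by apply: between_trans zb _; exact: wb.
  have [i lin dwi] := nearR w wb'.
  exists w; first by apply: betweenC.
  exists i => //; rewrite (distC hd w z) dzw; split=> //.
  have := gromov2E z w (p i); have := farz i lin.
  by rewrite (distC hd (p i) z) (distC hd w z); lia.
have [w1 w1b [i1 i1n [g1 d1 dz1]]] := side 0 (or_introl erefl).
have [w2 w2b [i2 i2n [g2 d2 dz2]]] := side n (or_intror erefl).
have zmid : between w1 z w2.
  apply: between_mid (_ : between w1 z (p n)) (betweenC w2b).
  apply: betweenC; apply: between_mid (betweenC zb) _; exact: betweenC.
have g0 := gromov2_between zmid.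
have d12 : d (p i1) (p i2) <= 6 * R.
  have := dist_tri hd w1 (p i1) (p i2); have := dist_tri hd w2 w1 (p i2).
  by move: zmid; rewrite /between (distC hd z w2) (distC hd (p i1) w1); lia.
have gstep l : l < n -> R.*2 - A <= gromov2 z (p l) (p l.+1).
  move=> ln; have := gromov2E z (p l) (p l.+1); have := step l ln.
  have := farz l; have := farz l.+1.
  by rewrite (distC hd z (p l)) (distC hd z (p l.+1)); lia.
have chain i j : i < j -> j <= n -> d (p i) (p j) <= 6 * R ->
    R.*2 - A <= gromov2 z (p i) (p j) + k * e.
  move=> ij jn dij; apply: gromov2_chain => [|l lij]; last by apply: gstep; lia.
  have := rev i j; rewrite (ltnW ij) jn => /(_ isT).
  have : A * (d (p i) (p j)).+1 <= A * (6 * R).+1 by rewrite leq_mul2l; lia.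
  lia.
have gmid : R.*2 - A <= gromov2 z (p i1) (p i2) + k * e.
  have [lt12|lt21|<-] := ltngtP i1 i2; first exact: chain.
    by rewrite gromov2C; apply: chain => //; rewrite (distC hd).
  by rewrite gromov2_xx; have := farz i1 i1n; rewrite (distC hd z); lia.
have := gromov2_four z w1 (p i1) w2; have := gromov2_four z (p i1) (p i2) w2.
by rewrite g0 (gromov2C z (p i2)); lia.
Qed.

(** Every point of the geodesic is close to the path, before or after p i.  Around
    the last point that is close to an earlier p j, the geodesic is also close to a
    later p k; so p j and p k are close, hence j and k, and i lies between them. *)
Lemma quasi_geodesic_near_geodesic A : exists C, forall n p,
  quasi_geodesic A n p -> forall i, i <= n -> gromov2 (p i) (p 0) (p n) <= C.
Proof.
have [R hR] := geodesic_near_quasi_geodesic A.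
pose E := A * (A * (R + R + e + 2)).
exists (R + E).*2 => n p qg i lin.
have [step rev] := qg.
suff [z zb dz] : exists2 z, between (p 0) z (p n) & d z (p i) <= R + E.
  have := gromov2E (p i) (p 0) (p n); move: zb; rewrite /between.
  have := dist_tri hd z (p 0) (p i); have := dist_tri hd z (p n) (p i).
  by rewrite (distC hd (p n) z); lia.
pose P t := `[< exists2 z, between (p 0) z (p n) & d (p 0) z = t /\
                  exists2 j, j <= i & d z (p j) <= R >].
have exP : exists t, P t.
  exists 0; apply/asboolP; exists (p 0); first by rewrite /between (dist_xx hd).
  by rewrite (dist_xx hd); split=> //; exists 0; rewrite ?(dist_xx hd).
have ubP t : P t -> t <= d (p 0) (p n).
  by move=> /asboolP[z zb [<- _]]; move: zb; rewrite /between; lia.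
case: (ex_maxnP exP ubP) => t /asboolP[z zb [dz [j ji dzj]]] tmax.
exists z => //.
suff [k kb dk] : exists2 k, i <= k <= n & d (p j) (p k) <= R + R + e + 1.
  have := rev j k; have := quasi_geodesic_lip qg (_ : j <= i <= n).
  rewrite ji lin => /(_ isT) dji.
  have -> : j <= k <= n by lia.
  move=> /(_ isT) kj.
  have : A * (i - j) <= E.
    rewrite leq_mul2l; apply/orP; right.
    by apply: leq_trans (_ : k - j <= _); first lia;
      apply: leq_trans kj _; rewrite leq_mul2l; lia.
  have := dist_tri hd (p j) z (p i); lia.
have [zn|zn] := posnP (d z (p n)).
  exists n; first by rewrite lin leqnn.
  have := dist_tri hd z (p j) (p n); rewrite (distC hd (p j) z); lia.
have [z' dz' z'b] : exists2 z', d (p 0) z' = t.+1 & between (p 0) z' (p n).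
  by apply: (dist_split hd); move: zb; rewrite /between; lia.
have [k kn dk] := hR n p qg z' z'b.
have ik : i <= k.
  rewrite leqNgt; apply/negP => ki.
  have : P t.+1 by apply/asboolP; exists z' => //; split=> //; exists k => //; exact: ltnW.
  by move/tmax; rewrite ltnn.
exists k; first by rewrite ik kn.
have := @near_geodesic_close (p 0) (p n) z z' 0 0; move: zb z'b.
rewrite /between => -> ->; rewrite addn0 leqnn => /(_ isT isT).
rewrite dz dz'.
have := dist_tri hd z (p j) (p k); have := dist_tri hd z' z (p k).
rewrite (distC hd (p j) z); lia.
Qed.

Lemma point_near_geodesic x y w C : gromov2 w x y <= C ->
  exists2 z, between x z y & d w z <= C + e.
Proof.
move=> gC; have gw := gromov2E w x y.
have [z dz zb] : exists2 z, d x z = minn (d x w) (d x y) & between x z y.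
  by apply: (dist_split hd); rewrite geq_minr.
exists z => //.
have := @near_geodesic_close x y w z C 0.
rewrite zb (distC hd w y) -gw addn0 leqnn => /(_ _ isT).
have := dist_tri hd x w y; have := dist_tri hd y x w.
rewrite (distC hd w x) (distC hd w y) in gw *.
rewrite dz; lia.
Qed.
End HyperbolicMetric.

(** * Lengths on hyperbolic groups *)

Local Open Scope group_scope.

Section Subgroups.
Variables (G : groupType) (H : set G).
Hypothesis subH : is_subgroup H.

Lemma subgroup1 : H 1.
Proof. by case: subH => + _; rewrite inE. Qed.

Lemma subgroupV x : H x -> H x^-1.
Proof. by move=> Hx; apply/set_mem/(group_closedV subH)/mem_set. Qed.

Lemma subgroupM x y : H x -> H y -> H (x * y).
Proof. by move=> Hx Hy; apply/set_mem/(group_closedM subH); apply/mem_set. Qed.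

Lemma subgroupX x n : H x -> H (x ^+ n).
Proof.
move=> Hx; elim: n => [|n IH]; first by rewrite expg0; exact: subgroup1.
by rewrite expgS; apply: subgroupM.
Qed.
End Subgroups.

Lemma generated_subgroup (G : groupType) (S : set G) : is_subgroup (generated S).
Proof.
split=> [|x y]; rewrite !inE; first by move=> A [sA _]; exact: subgroup1.
by move=> gx gy A [sA SA]; apply: subgroupM => //;
  [exact: gx|apply: subgroupV => //; exact: gy].
Qed.

Lemma pigeonhole (T : eqType) (s : seq T) (f : nat -> T) :
  (forall i, i <= size s -> f i \in s) ->
  exists i j, i < j <= size s /\ f i = f j.
Proof.
move=> fs; apply: contrapT => no.
have : uniq (map f (iota 0 (size s).+1)).
  rewrite map_inj_in_uniq ?iota_uniq // => i j.
  rewrite !mem_iota !add0n !ltnS => /andP[_ ix] /andP[_ jx] fij.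
  have [ij|ij|//] := ltngtP i j; exfalso; apply: no.
    by exists i, j; rewrite ij.
  by exists j, i; rewrite ij.
move=> un; have sub : {subset [seq f i | i <- iota 0 (size s).+1] <= s}.
  by move=> x /mapP[i]; rewrite mem_iota add0n ltnS => /andP[_ ix] ->; exact: fs.
by have := uniq_leq_size un sub; rewrite size_map size_iota ltnn.
Qed.

(** Left invariance is built in: the distance from x to y is the length of
    x^-1 * y. *)
Record hyperbolic_length (G : groupType) (len : G -> nat) (e : nat) : Prop :=
  HyperbolicLength {
    length_metric : hyperbolic_metric (fun x y : G => len (x^-1 * y)) e;
    length_ball : forall r, finite_set [set g | len g <= r] }.

Section HyperbolicLength.
Variables (G : groupType) (len : G -> nat) (e : nat).
Hypothesis hlen : hyperbolic_length len e.
Let hd := length_metric hlen.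
Notation d := (fun x y : G => len (x^-1 * y)).
Notation gp := (gromov2 d).
Implicit Types (a c g h s t u w x y z : G).

Lemma len1 : len 1 = 0.
Proof. by have := dist_xx hd 1; rewrite mulVg. Qed.

Lemma len_eq0 x : len x = 0 -> x = 1.
Proof. by move=> x0; apply/esym/(dist_eq0 hd); rewrite invg1 mul1g. Qed.

Lemma lenV x : len x^-1 = len x.
Proof. by have := distC hd x 1; rewrite mulg1 invg1 mul1g. Qed.

Lemma lenM x y : len (x * y) <= len x + len y.
Proof. by have := dist_tri hd 1 x^-1 y; rewrite !invgK mulg1 invg1 mul1g. Qed.

Lemma lenMl x y : len y <= len x + len (x * y).
Proof. by rewrite -{1}(mulKg x y) -(lenV x); exact: lenM. Qed.

Lemma lenMr x y : len x <= len (x * y) + len y.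
Proof. by rewrite -{1}(mulgK y x) -(lenV y); exact: lenM. Qed.

Lemma distMl g x y : len ((g * x)^-1 * (g * y)) = len (x^-1 * y).
Proof. by rewrite invgM -mulgA mulKg. Qed.

Lemma gpMl g w x y : gp (g * w) (g * x) (g * y) = gp w x y.
Proof. by rewrite /gromov2 !distMl. Qed.

Lemma gp1E x y : gp 1 x y + len (x^-1 * y) = len x + len y.
Proof. by have := gromov2E hd 1 x y; rewrite !mulg1 !lenV. Qed.

Lemma gp1_swap x y : gp 1 x y + gp 1 x^-1 (x^-1 * y) = (len x).*2.
Proof.
have := gromov2_swap hd 1 x y; rewrite mulg1 lenV => <-; congr addn.
by rewrite -(gpMl x) mulg1 mulgV mulVKg.
Qed.

Lemma gp1_four x y z : minn (gp 1 x y) (gp 1 y z) <= gp 1 x z + e.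
Proof. exact: (gromov2_four hd). Qed.

Lemma gp1C x y : gp 1 x y = gp 1 y x.
Proof. exact: (gromov2C hd). Qed.

Lemma gp1_le x y : gp 1 x y <= (len x).*2.
Proof. by have := gromov2_le hd 1 x y; rewrite mulg1 lenV. Qed.

Lemma len_split x k : k <= len x ->
  exists2 y, len y = k & len (y^-1 * x) + k = len x.
Proof.
rewrite -{1}(mul1g x) -{1}(invg1 G) => /(dist_split hd)[y].
by rewrite invg1 !mul1g => ly h; exists y => //; lia.
Qed.

Lemma ball_seq r : exists s : seq G, forall x, len x <= r -> x \in s.
Proof.
have /finite_seqP[s sE] := length_ball hlen r.
by exists s => x xr; have : [set` s] x by rewrite -sE.
Qed.

(** y prolongs a geodesic from 1 to g. *)
Definition cone g y := len (g * y) = len g + len y.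

(** Finiteness of cone types: the cone of g depends only on which elements z of
    bounded length shorten g.  If y were not in the cone of g', a geodesic from 1 to
    g' * y would pass near g', at a point g' * z that is closer to 1 than g'; then
    g * z is closer to 1 than g, and it gives a short cut to g * y. *)
Lemma cone_local g g' :
  (forall z, len z <= e.+2 -> (len (g * z) < len g) = (len (g' * z) < len g')) ->
  forall y, cone g y -> cone g' y.
Proof.
move=> gg' y; move: {2}(len y) (erefl (len y)) => n; elim: n y => [|n IH] y ly.
  by rewrite (len_eq0 ly) /cone !mulg1 len1 !addn0.
move=> cy; have [y' ly' l1] : exists2 y', len y' = n & len (y'^-1 * y) + n = len y.
  by apply: len_split; rewrite ly leqnSn.
have l2 x : len (x * y) <= len (x * y') + len (y'^-1 * y).
  by apply: leq_trans (lenM _ _); rewrite -mulgA mulVKg.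
have l2' x : len (x * y') <= len (x * y) + len (y'^-1 * y).
  rewrite -(lenV (y'^-1 * y)) invgM invgK.
  by apply: leq_trans (lenM _ _); rewrite -mulgA mulVKg.
have cy' : cone g y'.
  by rewrite /cone in cy *; have := l2 g; have := lenM g y'; lia.
have := IH y' ly' cy'; rewrite /cone => {}IH.
apply/eqP; rewrite eqn_leq lenM leqNgt; apply/negP => lt.
have hl := l2' g'.
have g'0 : 0 < len g'.
  rewrite lt0n; apply/eqP => /len_eq0 g'1; move: lt.
  by rewrite g'1 mul1g len1 add0n ltnn.
have [a la lay] : exists2 a, len a = (len g').-1 &
    len (a^-1 * (g' * y)) + (len g').-1 = len (g' * y).
  by apply: len_split; lia.
have lz : len (g'^-1 * a) <= e.+2.
  have := @near_geodesic_close _ _ _ hd 1 (g' * y) g' a 2 0.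
  rewrite !invg1 !mul1g mulKg la => h; apply: leq_trans (h _ _) _; lia.
have := gg' _ lz; rewrite mulVKg la.
have -> : (len g').-1 < len g' by lia.
have gy : g * y = g * (g'^-1 * a) * (a^-1 * (g' * y)).
  by rewrite -!mulgA mulVKg mulKg.
have := lenM (g * (g'^-1 * a)) (a^-1 * (g' * y)); rewrite -gy.
rewrite /cone in cy; lia.
Qed.

(** On a long geodesic two points p i and p j have the same cone.  The segment v
    between them can then be repeated: from p i it leads to p j, whose cone
    contains whatever the cone of p i contains, and in particular v again. *)
Lemma exists_axis : (forall n, exists g, n <= len g) ->
  exists2 v, 0 < len v & forall k, len (v ^+ k) = (k * len v)%N.
Proof.
move=> unb; have [s sP] := ball_seq e.+2.
pose S := enum {: (size s).-tuple bool}.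
have [g lg] := unb (size S).
have [p [p0 pn dp]] := geodesic_path hd (erefl (len (1^-1 * g))).
rewrite invg1 mul1g in dp pn.
have lp i : i <= size S -> len (p i) = i.
  have := dp 0 i; rewrite p0 invg1 mul1g subn0 => h hi; apply: h.
  by rewrite (leq_trans hi lg).
(* f i records which elements of the ball of radius e.+2 shorten p i. *)
pose f i : (size s).-tuple bool :=
  map_tuple (fun z => len (p i * z) < len (p i)) (in_tuple s).
have [i [j [ijS fij]]] := @pigeonhole _ S f (fun i _ => mem_enum _ _).
have [ij jS] := andP ijS.
have near z : len z <= e.+2 -> (len (p i * z) < len (p i)) = (len (p j * z) < len (p j)).
  move=> /sP; move: (congr1 val fij) => /= /eq_in_map; exact.
have lv := dp i j; rewrite (ltnW ij) (leq_trans jS lg) in lv.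
move/(_ isT) : lv; set v := _ * _ => lv.
have pj : p j = p i * v by rewrite /v mulVKg.
have li := lp i (leq_trans (ltnW ij) jS); have lj := lp j jS.
exists v; first by rewrite lv subn_gt0.
move=> k; suff [] : cone (p i) (v ^+ k) /\ len (v ^+ k) = (k * len v)%N by [].
elim: k => [|k [ck lk]].
  by rewrite expg0 /cone mulg1 len1 addn0.
have := cone_local near ck; rewrite /cone pj -mulgA -expgS -pj lj lk.
have := lenM (p i) (v ^+ k.+1); have := lenM v (v ^+ k).
rewrite -expgS mulSn lk li lv.
set a := len (v ^+ k.+1); set b := len (p i * _) => h1 h2 h3; split; lia.
Qed.

Section Axis.
Variable v : G.
Hypothesis v0 : 0 < len v.
Hypothesis lenX : forall k, len (v ^+ k) = (k * len v)%N.

(** The sign of the exponent is the boolean b, which keeps exponents natural. *)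
Definition axis (b : bool) i := (if b then v else v^-1) ^+ i.

Lemma len_axis b i : len (axis b i) = (i * len v)%N.
Proof. by case: b; rewrite /axis ?expVgn ?lenV. Qed.

Lemma axisV b i : (axis b i)^-1 = axis (~~ b) i.
Proof. by case: b; rewrite /axis /= expVgn ?invgK. Qed.

Lemma axisD b i j : axis b (i + j) = axis b i * axis b j.
Proof. exact: expgnDr. Qed.

Lemma axis_sub b i j : i <= j -> (axis b i)^-1 * axis b j = axis b (j - i).
Proof. by move=> ij; rewrite -{1}(subnKC ij) axisD mulKg. Qed.

Lemma axis_opp b i j : (axis (~~ b) i)^-1 * axis b j = axis b (i + j).
Proof. by rewrite axisV negbK axisD. Qed.

Lemma axis0 b : axis b 0 = 1.
Proof. exact: expg0. Qed.

Lemma near_axis b m n z : between d (axis b m) z (axis (~~ b) n) ->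
  exists b' i, len (z^-1 * axis b' i) <= len v + e.
Proof.
move=> bz; pose t := len ((axis b m)^-1 * z) %/ len v.
have ht := divn_eq (len ((axis b m)^-1 * z)) (len v).
rewrite -/t in ht; have hmod := ltn_pmod (len ((axis b m)^-1 * z)) v0.
have tmn : t <= m + n.
  have: len ((axis b m)^-1 * z) <= ((m + n) * len v)%N.
    by rewrite -(len_axis (~~ b)) -axis_opp negbK; move: bz; rewrite /between; lia.
  rewrite ht => h; rewrite -(leq_pmul2r v0); lia.
have {}bz := bz : _ = _.
have lpq : len ((axis b m)^-1 * axis (~~ b) n) = ((m + n) * len v)%N.
  by have := axis_opp (~~ b) m n; rewrite negbK => ->; rewrite len_axis.
(* x is the last power of v before z on the way from axis b m. *)
pose x := if t <= m then axis b (m - t) else axis (~~ b) (t - m).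
have [px xq] : len ((axis b m)^-1 * x) = (t * len v)%N /\
               len (x^-1 * axis (~~ b) n) = ((m + n - t) * len v)%N.
  rewrite /x; case: leqP => tm.
    split; last first.
      have := axis_opp (~~ b) (m - t) n; rewrite negbK => ->; rewrite len_axis.
      congr (_ * _)%N; lia.
    rewrite -lenV invgM invgK axis_sub ?leq_subr // len_axis; congr (_ * _)%N; lia.
  split.
    have := axis_opp (~~ b) m (t - m); rewrite negbK => ->; rewrite len_axis; congr (_ * _)%N; lia.
  rewrite axis_sub ?len_axis; [congr (_ * _)%N; lia|lia].
have [b' [i xE]] : exists b' i, x = axis b' i.
  by rewrite /x; case: ifP => _; [exists b, (m - t)|exists (~~ b), (t - m)].
exists b', i; rewrite -xE.
have := @near_geodesic_close _ _ _ hd (axis b m) (axis (~~ b) n) z x 0 0.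
rewrite px xq bz lpq !addn0 -mulnDl subnKC // leqnn => /(_ isT isT).
lia.
Qed.

Lemma conj_axis c b k m : c * axis true k = axis b k * c ->
  c * axis true (k * m)%N = axis b (k * m)%N * c /\
  c * axis false (k * m)%N = axis (~~ b) (k * m)%N * c.
Proof.
move=> ck; have ct : c * axis true (k * m)%N = axis b (k * m)%N * c.
  rewrite /axis !expgnA -/(axis true k) -/(axis b k).
  elim: m => [|m IH]; first by rewrite !expg0 mulg1 mul1g.
  by rewrite expgS mulgA ck -mulgA IH mulgA -expgS.
split=> //; rewrite -(axisV true) -(axisV b).
by apply: (mulgI (axis b (k * m))); rewrite mulVKg mulgA -ct mulgK.
Qed.

(** The translate by c of the axis of v stays at distance len c from that axis.  Both
    are geodesics, so their distance at the middle of very long segments is bounded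
    by a constant that does not depend on c. *)
Lemma commensurating_near_axis c b k : 0 < k -> c * axis true k = axis b k * c ->
  exists b' i, len (c^-1 * axis b' i) <= len v + 4 * e.
Proof.
move=> k0 /(@conj_axis c b k (len c + e).+1)[]; set M := (k * _)%N.
have MV : len c + e < M * len v by rewrite /M; nia.
set P := c * _ => PE; set P' := c * _ => P'E.
set p := axis b M in PE; set p' := axis (~~ b) M in P'E.
have lp : len p = (M * len v)%N by rewrite len_axis.
have lp' : len p' = (M * len v)%N by rewrite len_axis.
have dpP : len (P^-1 * p) = len c.
  by rewrite PE invgM mulgVK lenV.
have dpP' : len (p'^-1 * P') = len c by rewrite P'E mulKg.
have dPc : len (P^-1 * c) = (M * len v)%N.
  by rewrite /P invgM mulgVK lenV len_axis.
have dPc' : len (P'^-1 * c) = (M * len v)%N.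
  by rewrite /P' invgM mulgVK lenV len_axis.
have dPP : len (P^-1 * P') = (M * len v + M * len v)%N.
  by rewrite /P /P' distMl (axis_opp false) len_axis mulnDl.
have dpc := lenMr p^-1 c; have dpc' := lenMr p'^-1 c.
rewrite lenV lp in dpc; rewrite lenV lp' in dpc'.
have g1 := gromov2E hd c P p; have g2 := gromov2E hd c p' P'; have g3 := gromov2E hd c P P'.
rewrite dpP dPc in g1; rewrite dpP' dPc' in g2; rewrite dPP dPc dPc' in g3.
have f1 := gromov2_four hd c P p P'; have f2 := gromov2_four hd c p p' P'.
have gpp : gp c p p' <= 2 * e.
  move: MV g1 g2 g3 dpc dpc' f1 f2; set X := (M * len v)%N.
  set a := len (p^-1 * c); set a' := len (p'^-1 * c).
  set b1 := gp c P p; set b2 := gp c p P'; set b3 := gp c P P'.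
  set b4 := gp c p' P'; set b5 := gp c p p'.
  lia.
have [z zb dz] := point_near_geodesic hd gpp.
have [b' [i hi]] := near_axis zb.
exists b', i; have := dist_tri hd z c (axis b' i); lia.
Qed.

(** If a ray of the axis and a translated ray ran together for long enough, then
    c * v^i and v^i would differ by an element of a fixed ball for many values of
    i.  For two of these values it would be the same element, so that c conjugates
    a power of v to a power of v. *)
Lemma axis_diverge c :
  (forall b k, 0 < k -> c * axis true k <> axis b k * c) ->
  exists C, forall b b' m n, gp 1 (c * axis b m) (axis b' n) <= C.
Proof.
move=> nc; have [s sP] := ball_seq (3 * len c + 2 * e).
(* Two rays that run together this far do so for the first N powers of v. *)
pose N := size s; exists (2 * (N * len v + len c))%N => b b' m n.
rewrite leqNgt; apply/negP => big.
have hm := gp1_le (c * axis b m) (axis b' n); have hcm := lenM c (axis b m).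
have hn := gp1_le (axis b' n) (c * axis b m); rewrite gp1C in hn.
rewrite !len_axis in hcm hn.
have nc2 b0 b1 k : 0 < k -> c * axis b0 k <> axis b1 k * c.
  move=> k0; case: b0 => [|key]; first exact: nc.
  apply: (nc (~~ b1) _ k0); rewrite -axisV -(axisV false).
  by apply: (mulgI (axis b1 k)); rewrite mulVKg mulgA -key mulgK.
have Nm : N <= m by rewrite -(leq_pmul2r v0); lia.
have Nn : N <= n by rewrite -(leq_pmul2r v0); lia.
pose f i := (c * axis b i)^-1 * axis b' i.
have fs i : i <= size s -> f i \in s.
  move=> iN; apply: sP; rewrite /f.
  have im : i <= m by lia.
  have iin : i <= n by lia.
  have gx := gp1E (c * axis b i) (c * axis b m).
  have gy := gp1E (axis b' n) (axis b' i).
  have gxy := gp1E (c * axis b i) (axis b' i).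
  have lxi := lenM c (axis b i); have lxi' := lenMl c (axis b i).
  have lxm' := lenMl c (axis b m).
  rewrite distMl axis_sub // in gx.
  rewrite -lenV invgM invgK axis_sub // in gy.
  rewrite !len_axis in gx gy gxy lxi lxi' lxm'.
  have iNV : i * len v <= N * len v by rewrite leq_mul2r iN orbT.
  have imV : i * len v <= m * len v by rewrite leq_mul2r im orbT.
  have inV : i * len v <= n * len v by rewrite leq_mul2r iin orbT.
  rewrite mulnBl in gx; rewrite mulnBl in gy.
  have f1 := gp1_four (c * axis b i) (c * axis b m) (axis b' n).
  have f2 := gp1_four (c * axis b i) (axis b' n) (axis b' i).
  lia.
have [i [j [/andP[ij _] fij]]] := pigeonhole fs.
have k0 : 0 < j - i by lia.
have aij : axis b j = axis b (j - i) * axis b i by rewrite -axisD subnK // ltnW.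
have aij' : axis b j = axis b i * axis b (j - i) by rewrite -axisD subnKC // ltnW.
have bij : axis b' j = axis b' (j - i) * axis b' i by rewrite -axisD subnK // ltnW.
have key : c * axis b (j - i) = axis b' (j - i) * c.
  apply: (mulIg (axis b i)); apply: (mulIg (f i)).
  rewrite {2}/f -(mulgA _ c) -[RHS]mulgA mulVKg -bij -(mulgA c) -aij fij.
  by rewrite /f mulVKg.
exact: nc2 key.
Qed.
End Axis.

Lemma bounded_finite_index (H : set G) r : is_subgroup H ->
  (forall g, exists2 h, H h & len (g * h) <= r) -> finite_index H.
Proof.
move=> sH bd; pose cs := fun g : G => [set g * h | h in H].
apply: (@sub_finite_set _ _ [set cs g | g in [set g | len g <= r]]); last first.
  exact/finite_image/(length_ball hlen).
move=> _ [g _ <-]; have [h Hh gh] := bd g; exists (g * h) => //.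
apply/seteqP; split=> _ [h' Hh' <-].
  by exists (h * h'); [exact: subgroupM|rewrite mulgA].
exists (h^-1 * h'); last by rewrite mulgA mulgK.
by apply: subgroupM => //; exact: subgroupV.
Qed.

Lemma infinite_index_unbounded (H : set G) : is_subgroup H -> ~ finite_index H ->
  forall n, exists g, forall h, H h -> n < len (g * h).
Proof.
move=> sH nfi n; apply: contrapT => no; apply: nfi.
apply: (@bounded_finite_index _ n) => // g; apply: contrapT => far; apply: no.
exists g => h Hh; rewrite ltnNge; apply/negP => gh; apply: far; by exists h.
Qed.

Lemma gp_lip1 c x y : gp 1 (x * c) y <= gp 1 x y + (len c).*2.
Proof.
have := gromov2_lip hd 1 y (x * c) x; rewrite gp1C (gp1C y).
by rewrite invgM mulgVK lenV.
Qed.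

Lemma nonelementary_axis : ~ elementary_group G ->
  exists v, [/\ 0 < len v, forall k, len (v ^+ k) = (k * len v)%N &
                ~ finite_index (generated [set v])].
Proof.
(* If lengths were bounded, the trivial subgroup would have finite index. *)
move=> nel; have [n|v v0 lv] := exists_axis.
  have [|g gP] := @infinite_index_unbounded _ (generated_subgroup [set (1 : G)]) _ n.
    by move=> fi; apply: nel; exists 1.
  exists g; rewrite -[g]mulg1; apply/ltnW/gP; exact: subgroup1 (generated_subgroup _).
by exists v; split=> // fi; apply: nel; exists v.
Qed.

Lemma axis_generated v b i : generated [set v] (axis v b i).
Proof.
have sg := generated_subgroup [set v].
have gv : generated [set v] v by move=> A [_ vA]; exact: vA.
by apply: (subgroupX sg); case: b; [exact: gv|exact: (subgroupV sg) gv].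
Qed.

(** Take for t a long power of v, or its conjugate by an element c that is far from
    the axis of v.  The rays of the axis and of its translate diverge
    ([axis_diverge]), so s can follow at most one of the two candidates. *)
Lemma transverse_long_elements : ~ elementary_group G ->
  exists C, forall n s, exists t, [/\ n <= len t, gp 1 s t <= C & gp 1 s t^-1 <= C].
Proof.
move=> /nonelementary_axis[v [v0 lv nfi]].
have [c cP] := infinite_index_unbounded (generated_subgroup _) nfi (len v + 4 * e).
have [|C1 hC1] := @axis_diverge _ v0 lv c^-1.
  move=> b k k0 /(commensurating_near_axis v0 lv k0)[b' [i]].
  by rewrite leqNgt invgK cP //; exact: axis_generated.
exists (C1 + (len c).*2 + e) => n s.
pose N := (n + (len c).*2)%N.
pose t2 b := c^-1 * axis v b N * c.
have lN : N <= N * len v by rewrite leq_pmulr.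
have [good|] := pselect (forall b, gp 1 s (axis v b N) <= C1 + (len c).*2 + e).
  exists (axis v true N); split; [|exact: good|by rewrite axisV; exact: good].
  by rewrite len_axis // /N in lN *; lia.
move=> /existsNP[b /negP]; rewrite -ltnNge => bad.
have good2 b' : gp 1 s (t2 b') <= C1 + (len c).*2 + e.
  have := gp_lip1 c (c^-1 * axis v b' N) (axis v b N).
  have := hC1 b' b N N; have := gp1_four (t2 b') s (axis v b N).
  rewrite (gp1C (t2 b') s) -/(t2 b').
  set x1 := gp 1 _ _; set x2 := gp 1 (t2 b') _; set x3 := gp 1 (c^-1 * _) _.
  by move: bad; set x4 := gp 1 s _; lia.
exists (t2 true); split=> //.
  have := lenMr (c^-1 * axis v true N) c; have := lenMl c^-1 (axis v true N).
  rewrite len_axis // lenV -/(t2 true); set x1 := len (_ * _); set x2 := len (t2 true).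
  by rewrite /N in lN *; lia.
by rewrite /t2 !invgM invgK axisV mulgA; exact: good2.
Qed.

Section QuasiconvexSubgroup.
Variables (H : set G) (K : nat).
Hypothesis sH : is_subgroup H.
Hypothesis qH : forall h z, H h -> between d 1 z h ->
  exists2 h', H h' & len (z^-1 * h') <= K.

(** A geodesic from 1 to h follows u for a length equal to the Gromov product, and it
    stays near H.  A large product would therefore provide h' in H such that
    h'^-1 * u is shorter than u. *)
Lemma shortest_in_coset u h : (forall h, H h -> len u <= len (h * u)) -> H h ->
  gp 1 u h <= 2 * (K + e) + 1.
Proof.
move=> umin Hh; have := gp1_le h u; rewrite gp1C => gl.
have [z lz zh] := @len_split h (gp 1 u h)./2 (ltac:(lia)).
have [|h' Hh' dz] := qH Hh (_ : between d 1 z h).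
  by rewrite /between !invg1 !mul1g; lia.
have g1 := gp1E z h; have g2 := gp1_four u h z; have g3 := gp1E u z.
have := umin h'^-1 (subgroupV sH Hh'); rewrite -(lenV (h'^-1 * u)) invgM invgK.
have := dist_tri hd z u h'; rewrite gp1C in g1.
by set x := len (u^-1 * h'); lia.
Qed.

Lemma exists_shortest_in_coset n : ~ finite_index H ->
  exists u, n <= len u /\ forall h, H h -> len u <= len (h * u).
Proof.
move=> nfi; have [g gP] := infinite_index_unbounded sH nfi n.
pose P m := `[< exists2 h, H h & len (h * g^-1) = m >].
have exP : exists m, P m.
  by exists (len (1 * g^-1)); apply/asboolP; exists 1 => //; exact: subgroup1.
have [m /asboolP[h Hh lh] mmin] := ex_minnP exP.
exists (h * g^-1); split.
  rewrite -lenV invgM invgK; apply/ltnW/gP; exact: subgroupV.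
move=> h' Hh'; rewrite lh; apply: mmin; apply/asboolP.
by exists (h' * h); [exact: subgroupM|rewrite mulgA].
Qed.

Hypothesis nel : ~ elementary_group G.
Hypothesis nfi : ~ finite_index H.

(** Both u * t * u^-1 and its inverse u * t^-1 * u^-1 start like u, because t and t^-1
    do not follow u^-1; and u leaves H at once. *)
Lemma exists_transverse : exists C, forall n, exists2 g, n <= len g &
  forall h, H h -> gp 1 g h <= C /\ gp 1 g^-1 h <= C.
Proof.
have [C3 hC3] := transverse_long_elements nel.
exists (2 * (K + e) + 1 + e) => n.
have [u [nu umin]] := exists_shortest_in_coset (n + C3 + K + 3 * e + 2) nfi.
have uH h := @shortest_in_coset u h umin.
have [t [nt t1 t2]] := hC3 (C3 + e + n + 1) u^-1.
have claim s : len s = len t -> gp 1 u^-1 s <= C3 -> gp 1 u^-1 s^-1 <= C3 ->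
    n <= len (u * s * u^-1) /\
    forall h, H h -> gp 1 (u * s * u^-1) h <= 2 * (K + e) + 1 + e.
  move=> ls s1 s2; set g := u * s * u^-1.
  have gu : gp 1 u^-1 (u^-1 * g) <= C3 + e.
    have f := gp1_four u^-1 (s * u^-1) s; rewrite (gp1C _ s) in f.
    have := gp1_swap s (s * u^-1); rewrite mulKg (gp1C s^-1) => sw.
    have -> : u^-1 * g = s * u^-1 by rewrite /g !mulgA mulVg mul1g.
    by move: f sw; set x := gp 1 u^-1 (s * u^-1); set y := gp 1 s _; lia.
  have sw := gp1_swap u g.
  have lg : n <= len g.
    by have := gp1_le g u; rewrite (gp1C g u); move: sw gu; set x := gp 1 u^-1 _; lia.
  split=> // h Hh; have := uH h Hh; have := gp1_four u g h; lia.
have [n1 c1] := claim t erefl t1 t2.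
have [_ c2] := claim t^-1 (lenV t) t2 (ltac:(by rewrite invgK)).
exists (u * t * u^-1) => // h Hh; split; first exact: c1.
by rewrite !invgM invgK mulgA; exact: c2.
Qed.

(** W is the set of elements that leave H at once.  A product g * a * z belongs to it
    because it starts like g: a is long and z, which leaves H, does not cancel it.
    If a * z = a' * z', then z = h * z' with h = a^-1 * a' in H; here z' does not
    cancel h, so that z starts like h, and h has to be short since z is in W. *)
Lemma coded_products : exists (D L : nat) (g : G) (W : set G),
  [/\ W g,
      forall a z, H a -> L <= len a -> W z -> W (g * a * z) /\ len z < len (g * a * z) &
      forall a a' z z', H a -> H a' -> W z -> W z' -> a * z = a' * z' ->
        len (a^-1 * a') <= D].
Proof.
have [C hC] := exists_transverse; have [g lg gP] := hC (C + C + e + e).+2.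
pose W z := forall h, H h -> gp 1 z h <= C + e.
exists (C + e), (C + C + e + e).+2, g, W; split.
- by move=> h Hh; have [] := gP h Hh; lia.
- move=> a z Ha la Wz.
  have a1 := gp1_swap a (a * z); rewrite mulKg (gp1C a^-1) in a1.
  have a2 := Wz a^-1 (subgroupV sH Ha).
  have a3 := (gP a Ha).2.
  have a4 := gp1_four g^-1 (a * z) a; rewrite (gp1C (a * z) a) in a4.
  have a5 : gp 1 g^-1 (a * z) <= C + e by lia.
  have a6 := gp1_swap g (g * a * z); rewrite -mulgA mulKg in a6.
  rewrite -mulgA; split.
    move=> h Hh; have := (gP h Hh).1; rewrite (gp1C g h) (gp1C _ h).
    have := gp1_four h (g * (a * z)) g; rewrite (gp1C _ g).
    move: a5 a6; set x1 := gp 1 g (g * _); set x2 := gp 1 g^-1 _.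
    set x3 := gp 1 h _; set x4 := gp 1 h g; lia.
  have := gp1E g^-1 (a * z); rewrite invgK.
  have := gp1E a^-1 z; rewrite invgK (gp1C a^-1) !lenV.
  move: a5 a2; set x1 := gp 1 g^-1 _; set x2 := gp 1 z _.
  set y1 := len (a * z); set y2 := len (g * _); lia.
move=> a a' z z' Ha Ha' Wz Wz' azE.
pose h := a^-1 * a'.
have zE : z = h * z' by rewrite /h -mulgA -azE mulKg.
have Hh : H h by apply: subgroupM => //; exact: subgroupV.
have := gp1_swap h z; rewrite [in h^-1 * z]zE mulKg (gp1C h) (gp1C h^-1).
have := Wz h Hh; have := Wz' h^-1 (subgroupV sH Hh).
by rewrite -/h; set x1 := gp 1 z h; set x2 := gp 1 z' _; lia.
Qed.
End QuasiconvexSubgroup.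
End HyperbolicLength.

(** * Graph metrics and word metrics *)

Section GraphMetric.
Variable X : graph.
Implicit Types u v w : X.

Lemma walk_cat u s t w : walk u (s ++ t) w <-> exists2 v, walk u s v & walk v t w.
Proof.
elim: s u => [|x s IH] u /=; first by split=> [h|[v -> //]]; exists u.
split=> [[xu /IH[v sv tv]]|[v [xu sv] tv]]; first by exists v.
by split=> //; apply/IH; exists v.
Qed.

Lemma walk_rev u s v : walk u s v -> walk v (rev [seq rev_dart x | x <- s]) u.
Proof.
elim: s u => [|x s IH] u /=; first by move=> ->.
move=> [xu /IH h]; rewrite rev_cons -cats1; apply/walk_cat.
by exists (tgt x) => //=; split=> //; rewrite /tgt rev_dartK.
Qed.

Hypothesis conn : connected_graph X.

Lemma gdistP u v : (exists2 s, walk u s v & size s = gdist u v) /\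
  (forall s, walk u s v -> gdist u v <= size s).
Proof.
pose P n := `[< exists2 s, walk u s v & size s = n >].
have exP : exists n, P n.
  by have [s sw] := conn u v; exists (size s); apply/asboolP; exists s.
have [n /asboolP[s sw sn] nmin] := ex_minnP exP.
apply: (@xgetPex _ 0 [set n | (exists2 s, walk u s v & size s = n) /\
  (forall t, walk u t v -> n <= size t)]).
exists n; split; first by exists s.
by move=> t tw; apply: nmin; apply/asboolP; exists t.
Qed.

Lemma gdist_geodesic : geodesic_metric (@gdist X).
Proof.
have tri v u w : gdist u w <= gdist u v + gdist v w.
  have [[s sw <-] _] := gdistP u v; have [[t tw <-] _] := gdistP v w.
  by rewrite -size_cat; apply: (gdistP u w).2; apply/walk_cat; exists v.
have sym u v : gdist u v <= gdist v u.
  have [[s sw <-] _] := gdistP v u.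
  by rewrite -(size_map (@rev_dart X)) -size_rev; apply/(gdistP u v).2/walk_rev.
split=> [x|x y|x y|//|x y k kd].
- by apply/eqP; rewrite -leqn0; exact: ((gdistP x x).2 [::]).
- by move=> d0; have [[[|z s] //= sw sz] _] := gdistP x y; rewrite d0 in sz.
- by apply/eqP; rewrite eqn_leq !sym.
have [[s sw ss] _] := gdistP x y.
rewrite -(cat_take_drop k s) in sw; move/walk_cat : sw => [z zw1 zw2].
have := (gdistP x z).2 _ zw1; have := (gdistP z y).2 _ zw2.
rewrite size_drop size_takel ?ss // => h1 h2.
by have := tri z x y => h3; exists z; lia.
Qed.

Lemma quasiconvex_between (Y : set X) : quasiconvex Y ->
  exists K, forall x y z, Y x -> Y y -> between (@gdist X) x z y ->
    exists2 h, Y h & gdist z h <= K.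
Proof.
move=> [K hK]; exists K => x y z Yx Yy zb.
have [[s1 w1 sz1] _] := gdistP x z; have [[s2 w2 sz2] _] := gdistP z y.
apply: (hK x y (s1 ++ s2) Yx Yy _ s1 s2) => //.
split; first by apply/walk_cat; exists z.
by rewrite size_cat sz1 sz2.
Qed.

End GraphMetric.

Section WordMetric.
Variables (G : groupType) (S : set G).
Hypothesis gS : generated S = setT.

Definition cayley_actd (g : G) (x : dart (cayley S)) : dart (cayley S) :=
  let: (h, s, o) := x in (g * h, s, o).

(** Left multiplication, so that invariance of the word metric is an instance of
    invariance of the graph metric under automorphisms. *)
Definition cayley_action : graph_action G (cayley S).
Proof.
apply: (@GraphAction G (cayley S) (fun g h : G => g * h) cayley_actd).
- exact: mul1g.
- by move=> g h x; rewrite mulgA.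
- by move=> [[h s] o] /=; rewrite mul1g.
- by move=> g h [[k s] o] /=; rewrite mulgA.
- by move=> g [[k s] []] //=; rewrite mulgA.
- by move=> g [[k s] []].
Defined.

Lemma word_distMl (g x y : G) : word_dist S (g * x) (g * y) = word_dist S x y.
Proof. exact: (gdist_act cayley_action). Qed.

Definition word_len (g : G) := word_dist S 1 g.

Lemma word_distE (x y : G) : word_dist S x y = word_len (x^-1 * y).
Proof. by rewrite /word_len -(word_distMl x 1) mulg1 mulVKg. Qed.

Lemma cayley_connected : connected_graph (cayley S).
Proof.
pose C : set G := [set g | exists s, @walk (cayley S) 1 s g].
have sC : is_subgroup C.
  split=> [|x y]; rewrite !inE; first by exists [::].
  move=> [s sw] [t tw].
  have := walk_act cayley_action (x * y^-1) tw.
  rewrite (_ : cayley_action _ 1 = x * y^-1); last exact: mulg1.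
  rewrite (_ : cayley_action _ y = x); last exact: mulgVK.
  by move=> /walk_rev tw'; eexists; apply/walk_cat; exists x; [exact: sw|exact: tw'].
have Call g : C g.
  have : generated S g by rewrite gS.
  apply; split=> // s Ss.
  by exists [:: (1, SigSub (mem_set Ss), true)] => /=; split=> //; rewrite /tgt /= mul1g.
move=> u v; have [s sw] := Call (u^-1 * v).
have := walk_act cayley_action u sw.
rewrite (_ : cayley_action _ 1 = u); last exact: mulg1.
rewrite (_ : cayley_action _ _ = v); last exact: mulVKg.
by move=> h; eexists; exact: h.
Qed.
Lemma word_metric : geodesic_metric (fun x y : G => word_len (x^-1 * y)).
Proof.
have -> : (fun x y : G => word_len (x^-1 * y)) = @gdist (cayley S).
  by apply/funext => x; apply/funext => y; rewrite -word_distE.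
exact: (gdist_geodesic cayley_connected).
Qed.

Lemma word_len1 : word_len 1 = 0.
Proof. by have := dist_xx word_metric 1; rewrite mulVg. Qed.

Lemma word_len_eq0 g : word_len g = 0 -> g = 1.
Proof. by move=> g0; apply/esym/(dist_eq0 word_metric); rewrite invg1 mul1g. Qed.

Lemma word_len_step g n : word_len g = n.+1 ->
  exists h s, [/\ word_len h = n, S s & g = h * s \/ g = h * s^-1].
Proof.
move=> gn; have nl : n <= word_len (1^-1 * g) by rewrite invg1 mul1g gn leqnSn.
have [z] := dist_split word_metric nl; rewrite invg1 !mul1g => zn zg.
have {}zg : word_dist S z g = 1%N by rewrite word_distE; lia.
have [[t tw] + _] := gdistP cayley_connected z g.
rewrite -/(word_dist S z g) zg; case: t tw => [|[[k s] o] [|? ?]] //= [kz tg] _.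
exists z, (\val s); split=> //; first exact: set_valP.
by case: o kz tg; rewrite /tgt /= => <- <-; [left|right; rewrite mulgK].
Qed.

Hypothesis fS : finite_set S.

Lemma word_ball r : finite_set [set g | word_len g <= r].
Proof.
have /finite_seqP[t tE] := fS.
suff [s sP] : exists s : seq G, forall g, word_len g <= r -> g \in s.
  by apply: (@sub_finite_set _ _ [set` s]) => [g /sP //|]; exact: finite_seq.
elim: r => [|r [s sP]].
  exists [:: 1] => g; rewrite leqn0 => /eqP/word_len_eq0 ->; exact: mem_head.
exists (s ++ [seq x * y | x <- s, y <- t ++ [seq y^-1 | y <- t]]) => g.
rewrite leq_eqVlt ltnS mem_cat => /orP[/eqP|/sP -> //].
move=> /word_len_step[h [y [hr Sy gE]]]; apply/orP; right.
have yt : y \in t by rewrite tE in Sy.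
have hs : h \in s by apply: sP; rewrite hr.
by case: gE => ->; apply: allpairs_f => //; rewrite mem_cat ?yt // map_f ?orbT.
Qed.

Lemma le_word_len (l : G -> nat) : l 1 = 0 -> (forall g, l g^-1 = l g) ->
  (forall g h, l (g * h) <= l g + l h) -> exists A, forall g, l g <= A * word_len g.
Proof.
move=> l1 lV lM; have /finite_seqP[t tE] := fS.
exists (\max_(y <- t) l y) => g; move: {2}(word_len g) (erefl (word_len g)) => n.
elim: n g => [|n IH] g gn; first by rewrite (word_len_eq0 gn) l1.
have [h [y [hn Sy gE]]] := word_len_step gn.
have hl := IH h hn.
have yl : l y <= \max_(y <- t) l y.
  by apply: leq_bigmax_seq => //; rewrite tE in Sy.
by rewrite gn mulnSr -hn; case: gE => ->; apply: leq_trans (lM _ _) _;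
  rewrite ?lV leq_add.
Qed.

Lemma word_hyperbolic (R : realType) :
  gromov_hyperbolic (fun g h : G => (word_dist S g h)%:R%R : R) ->
  exists e, hyperbolic_length word_len e.
Proof.
move=> [delta hyp]; pose e := Num.bound `|2 * delta|%R.
have he : (2 * delta < e%:R)%R.
  by apply: le_lt_trans (ler_norm _) _; exact: archi_boundP (normr_ge0 _).
exists e; split; last exact: word_ball.
split=> [|w x y z]; first exact: word_metric.
have := hyp w x y z; rewrite /gromov_product !word_distE.
set dxw := word_len (x^-1 * w); set dyw := word_len (y^-1 * w).
set dxy := word_len (x^-1 * y); set dzw := word_len (z^-1 * w).
set dyz := word_len (y^-1 * z); set dxz := word_len (x^-1 * z).
rewrite minEle; case: ifP => _ h.
  have : (dxz + dyw <= dxy + dzw + e)%N by rewrite -(ler_nat R) !natrD; lra.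
  lia.
have : (dxz + dyw <= dyz + dxw + e)%N by rewrite -(ler_nat R) !natrD; lra.
lia.
Qed.
End WordMetric.

Lemma bounded_on_finite (T : Type) (A : set T) (f : T -> nat) : finite_set A ->
  exists D, forall x, A x -> f x <= D.
Proof.
move=> /(finite_image f)/finite_seqP[s sE].
exists (\max_(y <- s) y) => x Ax; apply: (@leq_bigmax_seq _ _ _ id) => //.
by have : [set` s] (f x) by rewrite -sE; exists x.
Qed.

(** H is quasiconvex for the word metric of S', while it is the word metric of S that
    is hyperbolic.  Geodesics for S' are quasi-geodesics for S, so a geodesic for S
    with both ends in H stays close to one for S', and hence to H. *)
Lemma quasiconvex_word_metric (G : groupType) (S : set G) (H : set G) e :
  finite_generating_set S -> hyperbolic_length (word_len S) e ->
  quasiconvex_subgroup H -> exists K, forall h z, H h ->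
    between (fun x y => word_len S (x^-1 * y)) 1 z h ->
    exists2 h', H h' & word_len S (z^-1 * h') <= K.
Proof.
move=> [fS gS] hlen [sH [S' [fS' gS'] qH]]; have hd := length_metric hlen.
have [A hA] : exists A, forall g, word_len S' g <= A * word_len S g.
  have wm := word_metric gS'.
  apply: le_word_len => //; first exact: word_len1.
    by move=> g; have := distC wm g 1; rewrite mulg1 invg1 mul1g.
  by move=> g h; have := dist_tri wm 1 g^-1 h; rewrite !invgK mulg1 invg1 mul1g.
have [A' hA'] : exists A, forall g, word_len S g <= A * word_len S' g.
  apply: le_word_len => //; first exact: word_len1.
    exact: (lenV hlen).
  exact: (lenM hlen).
have [K hK] := quasiconvex_between (cayley_connected gS') qH.
have [R hR] := geodesic_near_quasi_geodesic hd (A + A').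
exists (R + A' * K)%N => h z Hh zb.
have [p [p0 pn dp]] := geodesic_path (word_metric gS') (erefl (word_len S' (1^-1 * h))).
set n := word_len S' _ in pn dp.
have qg : quasi_geodesic (fun x y => word_len S (x^-1 * y)) (A + A') n p.
  split=> [i ltin|i j ijn].
    apply: leq_trans (hA' _) _; rewrite dp; nia.
  by rewrite -dp //; apply: leq_trans (hA _) _; nia.
have [|i lin di] := hR n p qg z; first by rewrite p0 pn.
have pb : between (@gdist (cayley S')) 1 (p i) h.
  have := dp 0 i; have := dp i n; rewrite p0 pn leqnn lin => /(_ isT) d1 /(_ isT) d2.
  by rewrite /between -!/(word_dist _ _ _) !word_distE // d1 d2 -/n; lia.
have [h' Hh' dh'] := hK 1 h (p i) (subgroup1 sH) Hh pb.
exists h' => //; have := dist_tri hd (p i) z h'.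
rewrite -/(word_dist _ _ _) word_distE // in dh'.
by have := hA' ((p i)^-1 * h'); nia.
Qed.

(** * Orbits in a graph *)

Section OrbitLength.
Variables (G : groupType) (X : graph) (a : graph_action G X) (b : X).
Hypothesis conn : connected_graph X.
Let dX := gdist_geodesic conn.
Implicit Types g h : G.

Definition orbit_len g := gdist b (a g b).

Lemma orbit_len1 : orbit_len 1 = 0.
Proof. by rewrite /orbit_len actv1 (dist_xx dX). Qed.

Lemma gdist_orbit g h : gdist (a g b) (a h b) = orbit_len (g^-1 * h).
Proof. by rewrite /orbit_len -(gdist_act a g b) -actvM mulVKg. Qed.

Lemma orbit_lenV g : orbit_len g^-1 = orbit_len g.
Proof. by rewrite /orbit_len -(gdist_act a g) -actvM mulgV actv1 (distC dX). Qed.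

Lemma orbit_lenM g h : orbit_len (g * h) <= orbit_len g + orbit_len h.
Proof.
apply: leq_trans (dist_tri dX (a g b) b _) _.
by rewrite gdist_orbit mulKg.
Qed.

Hypothesis cocpt : cocompact_action a.

Lemma cobounded_orbit : exists D, forall v : X, exists g, gdist (a g b) v <= D.
Proof.
pose orb v := range (fun g => a g v).
have pickP (O : set X) : exists v : X, O !=set0 -> O v.
  have [[v Ov]|O0] := pselect (O !=set0); first by exists v.
  by exists b => /O0.
have [r rP] := choice pickP.
have [D hD] := bounded_on_finite (fun O => gdist b (r O)) cocpt.1.
exists D => v; have fD := hD (orb v) (ltac:(by exists v)).
have [g _ gv] : orb v (r (orb v)).
  by apply: rP; exists v; exists 1 => //; exact: actv1.
exists g^-1; rewrite -(gdist_act a g) -actvM mulgV actv1 gv; exact: fD.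
Qed.

Hypothesis proper : proper_action a.
Variables (S : set G) (e : nat).
Hypothesis genS : finite_generating_set S.
Hypothesis hlen : hyperbolic_length (word_len S) e.
Let hd := length_metric hlen.
Notation len := (word_len S).
Notation d := (fun x y : G => len (x^-1 * y)).

Lemma orbit_len_le : exists A, forall g, orbit_len g <= A * len g.
Proof.
have [fS gS] := genS.
exact: (le_word_len gS fS orbit_len1 orbit_lenV orbit_lenM).
Qed.

(** The i-th point p i is an element that moves b near the i-th vertex of a geodesic
    from b to g b.  There is one more step than edges, because b may have a
    nontrivial stabilizer: the element found near the last vertex need not be g. *)
Lemma orbit_path : exists A D, forall g, exists p : nat -> G,
  [/\ p 0 = 1, p (orbit_len g).+1 = g, quasi_geodesic d A (orbit_len g).+1 p &
      forall i, i <= orbit_len g -> orbit_len (p i) <= i + D /\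
        orbit_len ((p i)^-1 * g) <= orbit_len g - i + D].
Proof.
have [D hD] := cobounded_orbit; have [A hA] := orbit_len_le.
have [B hB] := bounded_on_finite len (proper b (D + D + 1)).
exists (A + D + D + B + 1)%N, (D + D)%N => g; set n := orbit_len g.
have [v [v0 vn dv]] := geodesic_path dX (erefl n).
have [q hq] := choice (fun i => hD (v (minn i n))).
(* The ends are prescribed: p 0 = 1, and the additional last point is g. *)
pose p i := if i == 0 then 1 else if i == n.+1 then g else q i.
have hp i : i <= n.+1 -> gdist (a (p i) b) (v (minn i n)) <= D.
  move=> iN; rewrite /p; case: eqP => [->|_].
    by rewrite min0n v0 actv1 (dist_xx dX).
  case: eqP => [->|_]; last exact: hq.
  by rewrite (minn_idPr (leqnSn n)) vn (dist_xx dX).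
have dist_p i j : i <= j <= n.+1 ->
    orbit_len ((p i)^-1 * p j) <= D + (minn j n - minn i n) + D /\
    minn j n - minn i n <= D + orbit_len ((p i)^-1 * p j) + D.
  move=> /andP[ij jn]; have hi := hp i (leq_trans ij jn); have hj := hp j jn.
  have dij : gdist (v (minn i n)) (v (minn j n)) = minn j n - minn i n by apply: dv; lia.
  rewrite -gdist_orbit -dij.
  have t1 := dist_tri dX (v (minn i n)) (a (p i) b) (a (p j) b).
  have t2 := dist_tri dX (v (minn j n)) (v (minn i n)) (a (p j) b).
  have t3 := dist_tri dX (a (p i) b) (v (minn i n)) (v (minn j n)).
  have t4 := dist_tri dX (a (p j) b) (a (p i) b) (v (minn j n)).
  rewrite (distC dX (v (minn j n)) (a (p j) b)) in t2.
  rewrite (distC dX (v (minn i n)) (a (p i) b)) in t3.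
  lia.
have p0 : p 0 = 1 by [].
have pn : p n.+1 = g by rewrite /p eqxx.
exists p; split=> //.
  split=> [i lin|i j ijn].
    have [h _] := dist_p i i.+1 (ltac:(lia)).
    by have := hB ((p i)^-1 * p i.+1) (ltac:(rewrite /= -/(orbit_len _); lia)); lia.
  have [_ h] := dist_p i j ijn; have := hA ((p i)^-1 * p j); nia.
move=> i lin; have [h1 _] := dist_p 0 i (ltac:(lia)).
have [h2 _] := dist_p i n.+1 (ltac:(lia)).
by rewrite p0 invg1 mul1g in h1; rewrite pn in h2; lia.
Qed.

(** The i-th point of [orbit_path] is near a geodesic of the word metric from 1 to h,
    hence near an element h1 of H.  The path comes from a geodesic of the graph, so
    the lengths of its two parts add up to orbit_len h, up to a constant. *)
Lemma split_quasiconvex (H : set G) K : H 1 ->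
  (forall h z, H h -> between d 1 z h -> exists2 h', H h' & len (z^-1 * h') <= K) ->
  exists C, forall h i, H h -> i <= orbit_len h -> exists2 h1, H h1 &
    orbit_len h1 <= i + C /\ orbit_len (h1^-1 * h) <= orbit_len h - i + C.
Proof.
move=> H1 qH; have [A [D path]] := orbit_path; have [B hB] := orbit_len_le.
have [C hC] := quasi_geodesic_near_geodesic hd A.
exists (D + B * (C + e + K))%N => h i Hh ih.
have [p [p0 pn qg pl]] := path h; have [l1 l2] := pl i ih.
have := hC _ _ qg i (leqW ih); rewrite p0 pn.
move=> /(point_near_geodesic hd)[z zb dz]; have [h1 Hh1 d1] := qH h z Hh zb.
have dp : len ((p i)^-1 * h1) <= C + e + K.
  by apply: leq_trans (dist_tri hd z _ _) _; lia.
have lp : orbit_len ((p i)^-1 * h1) <= B * (C + e + K).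
  by apply: leq_trans (hB _) _; rewrite leq_mul2l dp orbT.
exists h1 => //; split.
  by have := orbit_lenM (p i) ((p i)^-1 * h1); rewrite mulVKg; lia.
have := orbit_lenM (h1^-1 * p i) ((p i)^-1 * h).
have -> : h1^-1 * p i * ((p i)^-1 * h) = h1^-1 * h by rewrite -mulgA mulVKg.
have := orbit_lenV ((p i)^-1 * h1); rewrite invgM invgK.
set x := orbit_len (h1^-1 * p i); lia.
Qed.
End OrbitLength.

(** * Exponential growth rates of sequences *)

Local Close Scope group_scope.
Local Open Scope ring_scope.

Section ExponentialRate.
Variable R : realType.
Implicit Types (c : nat -> nat) (mu x t : R).

Definition exp_rate c : \bar R := limn_esup (fun n => ((c n)%:R `^ (n%:R^-1))%:E).

Lemma root_le c n mu : (0 < n)%N -> 0 <= mu ->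
  ((c n)%:R `^ (n%:R^-1) <= mu) = ((c n)%:R <= mu ^+ n).
Proof.
move=> n0 mu0; have n0R : (n%:R : R) != 0 by rewrite pnatr_eq0 -lt0n.
have cE : ((c n)%:R `^ (n%:R^-1)) ^+ n = (c n)%:R :> R.
  by rewrite -powR_mulrn ?powR_ge0 // -powRrM mulVf // powRr1.
by rewrite -[in RHS]cE ler_pXn2r // nnegrE ?powR_ge0.
Qed.

Lemma exp_rate_le c mu n0 : 0 <= mu ->
  (forall n, (n0 <= n)%N -> (c n)%:R <= mu ^+ n) -> (exp_rate c <= mu%:E)%E.
Proof.
move=> mu0 hc; rewrite /exp_rate /limn_esup limf_esupE.
apply: le_trans (_ : ereal_sup [set ((c n)%:R `^ (n%:R^-1))%:E |
    n in [set n | (n0.+1 <= n)%N]] <= _)%E.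
  apply: ereal_inf_lbound; exists [set n | (n0.+1 <= n)%N] => //.
  exact: nbhs_infty_ge.
apply: ge_ereal_sup => _ [n /= n0n <-].
by rewrite lee_fin root_le ?hc //; lia.
Qed.

Lemma exp_rate_lt c mu : (exp_rate c < mu%:E)%E ->
  exists rho n0, [/\ 0 <= rho, rho < mu &
    forall n, (n0 < n)%N -> (c n)%:R <= rho ^+ n].
Proof.
rewrite /exp_rate /limn_esup limf_esupE => /ereal_inf_lt[_ [V [N _ NV] <-]] ltmu.
set s := ereal_sup _ in ltmu.
have us n : (N <= n)%N -> (((c n)%:R `^ (n%:R^-1))%:E <= s)%E.
  by move=> Nn; apply: ereal_sup_ubound; exists n => //; exact: NV.
have sfin : s \is a fin_num.
  rewrite fin_numE; apply/andP; split; apply/eqP => sE.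
    by have := us N (leqnn N); rewrite sE leeNy_eq.
  by move: ltmu; rewrite sE.
rewrite -(fineK sfin) lte_fin in ltmu.
exists (fine s), N; split=> //.
  by rewrite -lee_fin fineK //; apply: le_trans (us N (leqnn N)); rewrite lee_fin powR_ge0.
move=> n Nn; rewrite -root_le //; [|lia|].
  by rewrite -lee_fin fineK //; apply: us; lia.
by rewrite -lee_fin fineK //; apply: le_trans (us N (leqnn N)); rewrite lee_fin powR_ge0.
Qed.

Lemma le_exp_rate c c' n0 : (forall n, (n0 <= n)%N -> (c n <= c' n)%N) ->
  (exp_rate c <= exp_rate c')%E.
Proof.
move=> cc'; rewrite /exp_rate /limn_esup !limf_esupE.
apply/ereal_infP => _ [V VN <-].
apply: le_trans (_ : ereal_sup [set ((c n)%:R `^ (n%:R^-1))%:E |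
    n in V `&` [set n | (n0 <= n)%N]] <= _)%E.
  apply: ereal_inf_lbound; exists (V `&` [set n | (n0 <= n)%N]) => //.
  by apply: filterI => //; exact: nbhs_infty_ge.
apply: ge_ereal_sup => _ [n [Vn /= n0n] <-].
apply: le_trans (_ : ((c' n)%:R `^ (n%:R^-1))%:E <= _)%E; last first.
  by apply: ereal_sup_ubound; exists n.
by rewrite lee_fin ge0_ler_powR ?nnegrE ?invr_ge0 ?ler0n // ler_nat cc'.
Qed.

Lemma bernoulli t n : -1 <= t -> 1 + n%:R * t <= (1 + t) ^+ n.
Proof.
move=> t1; elim: n => [|n IH]; first by rewrite mul0r addr0 expr0.
have t0 : 0 <= 1 + t by lra.
rewrite exprSr; apply: le_trans (ler_wpM2r t0 IH).
rewrite -natr1; have : 0 <= n%:R * t ^+ 2 by rewrite mulr_ge0 ?sqr_ge0.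
nra.
Qed.

Section Submultiplicative.
Variables (c : nat -> nat) (B : nat).
Hypothesis c0 : forall n, (0 < c n)%N.
Hypothesis cmono : forall n m, (n <= m)%N -> (c n <= c m)%N.
Hypothesis csub : forall n m, (c (n + m) <= B * c n * c m)%N.

(** Writing m = q * n + r with r < n gives c m <= (B * c n)^q * c n, and the constant
    c n is absorbed by the q-th power of the ratio mu^n / (B * c n) > 1. *)
Lemma submultiplicative_rate_le n mu : (0 < n)%N -> 0 <= mu ->
  (B * c n)%:R < mu ^+ n -> (exp_rate c <= mu%:E)%E.
Proof.
move=> n0 mu0 lt; set x := (B * c n)%N in lt.
have B0 : (0 < B)%N by have := csub 0 0; have := c0 (0 + 0); case: (B) => //; rewrite !mul0n; lia.
have x0 : (0 < x)%N by rewrite muln_gt0 B0 c0.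
have xR : (1 : R) <= x%:R by rewrite ler1n.
have mu1 : 1 <= mu.
  rewrite leNgt; apply/negP => mu1.
  have : mu ^+ n <= 1 by rewrite exprn_ile1 // ltW.
  lra.
have cq q r : (r < n)%N -> (c (q * n + r) <= x ^ q * c n)%N.
  move=> rn; elim: q => [|q IH]; first by rewrite mul1n cmono // ltnW.
  rewrite mulSn -addnA expnS; apply: leq_trans (csub _ _) _.
  by rewrite -/x -(mulnA x) leq_mul2l IH orbT.
pose t := mu ^+ n / x%:R - 1.
have t0 : 0 < t by rewrite subr_gt0 ltr_pdivlMr ?mul1r // (lt_le_trans _ xR).
pose Q := Num.bound ((c n)%:R / t).
apply: (@exp_rate_le _ _ (Q * n)%N) => // m hm.
rewrite (divn_eq m n); set q := (m %/ n)%N; set r := (m %% n)%N.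
have rn : (r < n)%N by rewrite ltn_mod.
have Qq : (Q <= q)%N by rewrite leq_divRL.
apply: le_trans (_ : (x ^ q * c n)%:R <= _); first by rewrite ler_nat cq.
rewrite exprD natrM natrX (mulnC q) exprM.
have xq : 0 < x%:R ^+ q :> R by rewrite exprn_gt0 // (lt_le_trans _ xR).
apply: le_trans (_ : x%:R ^+ q * (1 + t) ^+ q <= _).
  rewrite ler_pM2l //; apply: le_trans (bernoulli _ _); last lra.
  have : (c n)%:R / t < q%:R.
    apply: lt_le_trans (archi_boundP _) _; first by rewrite divr_ge0 // ltW.
    by rewrite ler_nat.
  by rewrite ltr_pdivrMr //; lra.
rewrite -exprMn /t addrC subrK mulrCA divff ?mulr1; last by rewrite gt_eqF // (lt_le_trans _ xR).
by rewrite ler_peMr ?exprn_ge0 // ?exprn_ege1 // exprn_ge0.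
Qed.

(** Fekete's argument: lam is the infimum of the n-th roots of B * c n, over n > 0. *)
Lemma submultiplicative_rate : exists lam : R, [/\ 1 <= lam, (exp_rate c <= lam%:E)%E &
  forall n, lam ^+ n <= (B * c n)%:R].
Proof.
have B0 : (0 < B)%N by have := csub 0 0; have := c0 (0 + 0); case: (B) => //; rewrite !mul0n; lia.
have bc n : (0 < B * c n)%N by rewrite muln_gt0 B0 c0.
pose y n : R := (B * c n)%:R `^ (n%:R^-1).
have yX n : (0 < n)%N -> y n ^+ n = (B * c n)%:R.
  move=> n0; have n0R : (n%:R : R) != 0 by rewrite pnatr_eq0 -lt0n.
  by rewrite -powR_mulrn ?powR_ge0 // -powRrM mulVf // powRr1.
pose E := [set y n.+1 | n in setT].
have E0 : E !=set0 by exists (y 1); exists 0%N.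
have E1 : lbound E 1.
  move=> _ [n _ <-]; rewrite leNgt; apply/negP => y1.
  have : y n.+1 ^+ n.+1 < 1 by rewrite exprn_ilt1 // powR_ge0.
  by rewrite yX // ltrn1; have := bc n.+1; lia.
have lam1 : 1 <= inf E by exact: lb_le_inf.
exists (inf E); split=> //.
  apply/lee_addgt0Pr => eps eps0; rewrite -EFinD.
  have [_ [n _ <-] lt] := inf_adherent eps0 (conj E0 (ex_intro _ 1 E1)).
  apply: (@submultiplicative_rate_le n.+1) => //; first lra.
  rewrite -yX //; apply: ltrXn2r => //; exact: powR_ge0.
case=> [|n]; first by rewrite expr0 ler1n.
rewrite -yX //; apply: lerXn2r; rewrite ?nnegrE ?powR_ge0 //; first lra.
by apply: ge_inf; [exists 1|exists n].
Qed.
End Submultiplicative.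
End ExponentialRate.

(** * Counting elements by length *)

Section Counting.
Variables (G : groupType) (l : G -> nat).
Hypothesis lfin : forall r, finite_set [set g | (l g <= r)%N].
Implicit Types (H : set G) (s A : seq G).

Definition lball H n : {fset G} := fset_set [set h | H h /\ (l h <= n)%N].
(** For the length l of orbits, this is convertible to [growth_function]. *)
Definition cnt H n := #|` lball H n|.

Lemma mem_lball H n h : (h \in lball H n) = `[< H h /\ (l h <= n)%N >].
Proof.
rewrite in_fset_set; first by apply/idP/asboolP => [/set_mem|/mem_set].
by apply: sub_finite_set (lfin n) => x [].
Qed.

Lemma lballP H n h : reflect (H h /\ (l h <= n)%N) (h \in lball H n).
Proof. by rewrite mem_lball; exact: asboolP. Qed.

Lemma cnt_ge H n s : uniq s -> (forall h, h \in s -> H h /\ (l h <= n)%N) ->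
  (size s <= cnt H n)%N.
Proof. by move=> us sP; apply: uniq_leq_size => // h /sP/lballP. Qed.

Lemma cnt_le H n s : (forall h, H h -> (l h <= n)%N -> h \in s) -> (cnt H n <= size s)%N.
Proof. by move=> sP; apply: uniq_leq_size; rewrite ?fset_uniq // => h /lballP[]; exact: sP. Qed.

Lemma cnt_mono H n m : (n <= m)%N -> (cnt H n <= cnt H m)%N.
Proof. by move=> nm; apply: cnt_le => h Hh hn; apply/lballP; split=> //; lia. Qed.

Section SubmultiplicativeCount.
Variables (H : set G) (C : nat).
Hypothesis sH : is_subgroup H.
Hypothesis l1 : l 1%g = 0%N.
Hypothesis split : forall h i, H h -> (i <= l h)%N -> exists2 h1, H h1 &
  (l h1 <= i + C /\ l (h1^-1 * h)%g <= l h - i + C)%N.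

Lemma cnt_gt0 n : (0 < cnt H n)%N.
Proof.
apply: (@cnt_ge H n [:: 1%g]) => // h; rewrite inE => /eqP ->.
by rewrite l1; split=> //; exact: subgroup1.
Qed.

(** An element cut into two parts is determined by them. *)
Lemma cntD n m : (cnt H (n + m) <= cnt H (n + C) * cnt H (m + C))%N.
Proof.
rewrite -(size_allpairs (fun x y => x * y)%g); apply: cnt_le => h Hh lh.
have [h1 Hh1 [lh1 lh2]] := split Hh (geq_minr n (l h)).
rewrite -(mulVKg h1 h); apply: allpairs_f; apply/lballP; split=> //; first lia.
  by apply: subgroupM => //; exact: subgroupV.
by apply: leq_trans lh2 _; lia.
Qed.

(** Cutting at length n - C leaves a first part of length at most n and a second one
    of bounded length. *)
Lemma cnt_shift n : (cnt H (n + C) <= cnt H n * cnt H (3 * C))%N.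
Proof.
have [nC|Cn] := ltnP n C.
  apply: leq_trans (_ : cnt H (3 * C) <= _)%N; first by apply: cnt_mono; lia.
  by rewrite leq_pmull // cnt_gt0.
have := cntD (n - C) (2 * C); rewrite subnK //.
have -> : (n - C + 2 * C = n + C)%N by lia.
by have -> : (2 * C + C = 3 * C)%N by lia.
Qed.

Lemma cnt_submultiplicative n m :
  (cnt H (n + m) <= cnt H (3 * C) ^ 2 * cnt H n * cnt H m)%N.
Proof.
apply: leq_trans (cntD n m) _; apply: leq_trans (leq_mul (cnt_shift n) (cnt_shift m)) _.
by rewrite expnS expn1; lia.
Qed.
End SubmultiplicativeCount.

Variable R : realType.
Implicit Types x : R.

(** Summation by parts, where the double sum is the one of the x^n over the pairs of
    an element g and an integer n >= l g. *)
Lemma sum_layers x s m M :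
  \sum_(g <- s) \sum_(m <= n < M | (l g <= n)%N) x ^+ n =
  \sum_(m <= n < M) (count (fun g => l g <= n)%N s)%:R * x ^+ n.
Proof.
rewrite (exchange_big_dep xpredT) //=; apply: eq_bigr => n _.
by rewrite big_const_seq iter_addr_0 mulr_natl.
Qed.

Lemma geometric_le x m M : 0 <= x <= 1 -> (1 - x) * \sum_(m <= k < M) x ^+ k <= x ^+ m.
Proof.
move=> /andP[x0 x1]; move: {2}(M - m)%N (erefl (M - m)%N) => n.
elim: n m => [|n IH] m Mm.
  by rewrite big_geq ?mulr0 ?exprn_ge0 //; lia.
rewrite big_ltn; last lia.
by have := IH m.+1 ltac:(lia); rewrite exprS; lra.
Qed.

(** If lam > 1 and th = 1 / lam, then th^(l h) is at least (1 - th) times the sum of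
    the th^n for n >= l h.  Summing over h, the n-th term is cnt H n * th^n, which
    is at least 1 / B by hypothesis.  If lam = 1, every element has weight 1. *)
Lemma poincare_diverges H lam (B : nat) : infinite_set H -> 1 <= lam ->
  (forall n, lam ^+ n <= (B * cnt H n)%:R) ->
  forall M : R, exists n, M <= \sum_(h <- lball H n) lam^-1 ^+ l h.
Proof.
move=> Hinf lam1 hlam M; have lam0 : 0 < lam by lra.
have [lamE|lamN] := eqVneq lam 1.
  have [A AH sA] := infinite_set_fset (Num.bound `|M|) Hinf.
  exists (\max_(h <- A) l h).
  rewrite (eq_bigr (fun=> 1)); last by move=> h _; rewrite lamE invr1 expr1n.
  rewrite big_const_seq iter_addr_0 count_predT.
  have : (#|` A| <= cnt H (\max_(h <- A) l h))%N.
    apply: cnt_ge; first exact: fset_uniq.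
    move=> h hA; split; first exact: AH.
    exact: leq_bigmax_seq.
  rewrite /cnt -(ler_nat R) => h1; rewrite -(ler_nat R) in sA.
  have h2 := ler_norm M; have h3 := archi_boundP (normr_ge0 M).
  by rewrite /cnt in h1; lra.
have {lamN lam1} lam1 : 1 < lam by rewrite lt_neqAle eq_sym lamN.
set th := lam^-1; have th0 : 0 < th by rewrite invr_gt0.
have th1 : th < 1 by rewrite invf_lt1.
have B0 : (0 < B)%N by have := hlam 0; rewrite expr0; case: (B) => //; rewrite mul0n ler10.
have BR : 0 < B%:R :> R by rewrite ltr0n.
(* n terms, each at least (1 - th) / B. *)
pose n := Num.bound `|M * B%:R / (1 - th)|; exists n.
have step g : (1 - th) * \sum_(0 <= k < n | (l g <= k)%N) th ^+ k <= th ^+ l g.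
  rewrite -(@big_nat_widenl _ _ _ (l g) 0 n xpredT) //.
  by apply: geometric_le; rewrite !ltW.
apply: le_trans (ler_sum _ (fun g _ => step g)).
rewrite -mulr_sumr sum_layers.
have low k : (0 <= k < n)%N -> B%:R^-1 <=
    (count (fun g => l g <= k)%N (lball H n))%:R * th ^+ k.
  move=> /= kn; have : (cnt H k <= count (fun g => l g <= k)%N (lball H n))%N.
    rewrite -size_filter; apply: cnt_le => h Hh hk.
    by rewrite mem_filter hk; apply/lballP; split=> //; lia.
  rewrite -(ler_nat R) => h1; have := hlam k; rewrite natrM => h2.
  rewrite -[X in X <= _]mul1r ler_pdivrMr //.
  apply: le_trans (_ : th ^+ k * lam ^+ k <= _).
    by rewrite -exprMn mulVf ?expr1n // gt_eqF.
  rewrite (mulrC _ (th ^+ k)) -mulrA ler_pM2l ?exprn_gt0 // mulrC.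
  by apply: le_trans h2 _; rewrite ler_pM2l.
have : n%:R * B%:R^-1 <= \sum_(0 <= k < n) (count (fun g => l g <= k)%N (lball H n))%:R * th ^+ k.
  rewrite -[in n%:R](subn0 n) mulr_natl -sumr_const_nat.
  by rewrite !big_nat; apply: ler_sum.
have h3 := archi_boundP (normr_ge0 (M * B%:R / (1 - th))).
have h4 := ler_norm (M * B%:R / (1 - th)); rewrite -/n in h3.
have h5 : M * B%:R / (1 - th) <= n%:R by lra.
move=> h6; have : (1 - th) * (n%:R / B%:R) <= (1 - th) *
    \sum_(0 <= k < n) (count (fun g => l g <= k)%N (lball H n))%:R * th ^+ k.
  by rewrite ler_pM2l ?subr_gt0.
apply: le_trans.
by move: h5; rewrite ler_pdivrMr ?subr_gt0 // mulrA ler_pdivlMr //; lra.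
Qed.
End Counting.

(** * Growth of coded products *)

Lemma expr_lt_eps (R : realType) (t eps : R) : 0 <= t < 1 -> 0 < eps ->
  exists n, forall m, (n <= m)%N -> t ^+ m < eps.
Proof.
move=> /andP[t0 t1] eps0; have [->|tN] := eqVneq t 0.
  by exists 1%N => m m1; rewrite expr0n; case: m m1.
have {tN} t0 : 0 < t by rewrite lt_neqAle eq_sym tN.
have u0 : 0 < t^-1 - 1 by rewrite subr_gt0 invf_gt1.
pose n := Num.bound (eps^-1 / (t^-1 - 1)); exists n => m nm.
rewrite -[t]invrK exprVn invf_plt ?posrE ?exprn_gt0 ?invr_gt0 //.
have h := bernoulli m (_ : -1 <= t^-1 - 1).
apply: lt_le_trans (_ : 1 + m%:R * (t^-1 - 1) <= _); last first.
  by apply: le_trans (h _) _; [lra|rewrite addrC subrK].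
have : eps^-1 / (t^-1 - 1) < m%:R.
  apply: lt_le_trans (archi_boundP _) _; last by rewrite ler_nat.
  by rewrite divr_ge0 ?invr_ge0 // ltW.
by rewrite ltr_pdivrMr //; lra.
Qed.

Lemma sum_undup_ge (R : realType) (T : choiceType) (s : seq T) (F : T -> R) N :
  (forall x, 0 <= F x) -> (forall x, count_mem x s <= N)%N ->
  \sum_(x <- s) F x <= N%:R * \sum_(x <- undup s) F x.
Proof.
move=> F0 sN; rewrite -big_undup_iterop_count /= mulr_sumr.
apply: ler_sum => x _; apply: le_trans (_ : (count_mem x s)%:R * F x <= _).
  by rewrite mulr_natl.
by rewrite ler_wpM2r // ler_nat.
Qed.

Section CodedGrowth.
Variables (G : groupType) (l len : G -> nat) (e : nat).
Hypothesis lfin : forall r, finite_set [set g | (l g <= r)%N].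
Hypothesis lM : forall g h, (l (g * h)%g <= l g + l h)%N.
Hypothesis hlen : hyperbolic_length len e.
Variables (H : set G) (D L : nat) (g : G) (W : set G).
Hypothesis Wg : W g.
Hypothesis Wstep : forall a z, H a -> (L <= len a)%N -> W z ->
  W (g * a * z)%g /\ (len z < len (g * a * z)%g)%N.
Hypothesis Wcode : forall a a' z z', H a -> H a' -> W z -> W z' ->
  (a * z = a' * z')%g -> (len (a^-1 * a')%g <= D)%N.

Definition products (A V : seq G) := [seq (g * a * z)%g | a <- A, z <- V].

(** All first factors a in the representations g * a * z of y are within D of one of
    them, and a determines z. *)
Lemma products_multiplicity s A V y : (forall h, (len h <= D)%N -> h \in s) ->
  uniq A -> uniq V -> (forall a, a \in A -> H a) -> (forall z, z \in V -> W z) ->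
  (count_mem y (products A V) <= size s)%N.
Proof.
move=> sP uA uV HA WV.
rewrite /products -(map_allpairs (fun p : G * G => g * p.1 * p.2)%g pair).
rewrite count_map -size_filter; set P := [seq _ <- _ | _].
have uP : uniq P by rewrite filter_uniq // allpairs_uniq // => -[? ?] [].
have PP p : p \in P -> [/\ p.1 \in A, p.2 \in V & (g * p.1 * p.2 = y)%g].
  by rewrite mem_filter => /andP[/eqP py /allpairsP[q [qA qV pE]]]; rewrite pE in py *.
case: P uP PP => [//|p0 P] uQ PQ.
have [A0 V0 y0] := PQ p0 (mem_head _ _).
rewrite -(size_map (fun p : G * G => p0.1^-1 * p.1)%g (p0 :: P)).
apply: uniq_leq_size.
  rewrite map_inj_in_uniq // => -[a z] [a' z'] /PQ[/= aA zV yE] /PQ[/= a'A z'V yE'].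
  by move=> /mulgI aa'; rewrite aa' -yE' in yE *; move/mulgI : yE => ->.
move=> _ /mapP[[a z] /PQ[/= aA zV yE] ->]; apply: sP.
apply: (@Wcode _ _ p0.2 z); [exact: HA|exact: HA|exact: WV|exact: WV|].
by apply: (mulgI g); rewrite !mulgA y0 yE.
Qed.

Fixpoint words A k : seq G :=
  if k is k'.+1 then undup (products A (words A k')) else [:: g].

Lemma wordsP A k : (forall a, a \in A -> H a /\ (L <= len a)%N) ->
  uniq (words A k) /\ forall z, z \in words A k -> W z /\ (k <= len z)%N.
Proof.
move=> AP; elim: k => [|k [_ IH]]; first by split=> // z; rewrite inE => /eqP ->.
split=> [|z]; first exact: undup_uniq.
rewrite mem_undup => /allpairsP[[a y] [/= /AP[Ha la] /IH[Wy ky] ->]].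
by have [W' lt] := Wstep Ha la Wy; split=> //; exact: leq_ltn_trans lt.
Qed.

Variable R : realType.
Implicit Types x th : R.

(** Each product g * a * z has at least the weight of its factors multiplied
    together, and it is counted at most size s times; the hypothesis on A compensates
    for this loss. *)
Lemma words_weight s A x k : (forall h, (len h <= D)%N -> h \in s) -> uniq A ->
  (forall a, a \in A -> H a /\ (L <= len a)%N) -> 0 < x <= 1 ->
  (size s)%:R <= x ^+ l g * \sum_(a <- A) x ^+ l a ->
  x ^+ l g <= \sum_(z <- words A k) x ^+ l z.
Proof.
move=> sP uA AP /andP[x0 x1] big.
have s0 : 0 < (size s)%:R :> R.
  have : (1%g : G) \in s by apply: sP; rewrite (len1 hlen).
  by rewrite ltr0n; case: (s).
elim: k => [|k IH]; first by rewrite big_seq1.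
apply: le_trans IH _; have [uV VP] := wordsP k AP.
rewrite -(ler_pM2l s0).
apply: le_trans (_ : \sum_(y <- products A (words A k)) x ^+ l y <= _); last first.
  apply: sum_undup_ge => [y|y]; first by rewrite exprn_ge0 // ltW.
  by apply: products_multiplicity => // [a /AP[]|z /VP[]].
apply: le_trans (_ : x ^+ l g * (\sum_(a <- A) x ^+ l a) *
    \sum_(z <- words A k) x ^+ l z <= _).
  by rewrite ler_wpM2r // sumr_ge0 // => z _; rewrite exprn_ge0 // ltW.
rewrite big_allpairs_dep -mulrA mulr_suml mulr_sumr; apply: ler_sum => a _.
rewrite !mulr_sumr; apply: ler_sum => z _; rewrite -!exprD.
rewrite ler_wiXn2l //; first exact: ltW.
by apply: leq_trans (lM _ _) _; rewrite addnA leq_add2r.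
Qed.

(** A crude bound: z is counted in every layer k >= l z, whereas the layer l z alone
    accounts for its weight. *)
Lemma weight_tail_le (V : seq G) x n m : uniq V -> 0 <= x ->
  (forall z, z \in V -> (n <= l z < m)%N) ->
  \sum_(z <- V) x ^+ l z <= \sum_(n <= k < m) (cnt l setT k)%:R * x ^+ k.
Proof.
move=> uV x0 VP.
apply: le_trans (_ : \sum_(n <= k < m) (count (fun z => l z <= k)%N V)%:R * x ^+ k <= _).
  rewrite -sum_layers big_seq [leRHS]big_seq; apply: ler_sum => z /VP zV.
  rewrite big_mkcond (bigD1_seq (l z)) ?iota_uniq ?mem_index_iota //= leqnn lerDl.
  by rewrite sumr_ge0 // => k _; case: ifP => // _; rewrite exprn_ge0.
apply: ler_sum => k _; rewrite ler_wpM2r ?exprn_ge0 // ler_nat -size_filter.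
apply: cnt_ge => //; first exact: filter_uniq.
by move=> h; rewrite mem_filter => /andP[].
Qed.

(** Choose A finite with weight at lam^-1 more than enough for [words_weight], then
    decrease lam^-1 to some x that keeps half of each weight.  If the growth rate
    were at most lam, which is less than 1 / x, the sum of x^(l z) over all z with
    l z >= N would tend to 0 with N.  But the words of k factors have length at
    least k and a total weight bounded below. *)
Lemma coded_growth (lam : R) : 1 <= lam ->
  (forall M : R, exists n, M <= \sum_(h <- lball l H n) lam^-1 ^+ l h) ->
  (lam%:E < exp_rate R (cnt l setT))%E.
Proof.
move=> lam1 div; have lam0 : 0 < lam by lra.
set th := lam^-1 in div; have th0 : 0 < th by rewrite invr_gt0.
have th1 : th <= 1 by rewrite invf_le1.
have [s sP] := ball_seq hlen D; have [sL sLP] := ball_seq hlen L.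
have [n] := div (4 * (size s)%:R / th ^+ l g + (size sL)%:R).
rewrite (bigID (fun h => L <= len h)%N) /= => hn.
have small : \sum_(h <- lball l H n | ~~ (L <= len h)%N) th ^+ l h <= (size sL)%:R.
  apply: le_trans (_ : \sum_(h <- lball l H n | ~~ (L <= len h)%N) 1 <= _).
    by apply: ler_sum => h _; rewrite exprn_ile1 // ltW.
  rewrite big_const_seq iter_addr_0 ler_nat -size_filter; apply: uniq_leq_size.
    by rewrite filter_uniq // fset_uniq.
  by move=> h; rewrite mem_filter -ltnNge => /andP[/ltnW/sLP].
pose A := [seq h <- lball l H n | (L <= len h)%N].
have uA : uniq A by rewrite filter_uniq // fset_uniq.
have AP a : a \in A -> H a /\ (L <= len a)%N.
  by rewrite mem_filter => /andP[la /(lballP lfin)[Ha _]].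
have lA a : a \in A -> (l a <= n)%N.
  by rewrite mem_filter => /andP[_ /(lballP lfin)[_]].
rewrite -big_filter -/A in hn.
have {}hn : 4 * (size s)%:R / th ^+ l g <= \sum_(a <- A) th ^+ l a by lra.
rewrite ler_pdivrMr ?exprn_gt0 // in hn.
(* By Bernoulli's inequality (1 - eta)^k >= 1/2 for all exponents k that occur
   for g and for the elements of A. *)
pose K := (n + l g)%N; pose eta : R := (2 * K.+1)%:R^-1.
have eta0 : 0 < eta by rewrite invr_gt0 ltr0n.
have etaK k : (k <= K)%N -> 2^-1 <= (1 - eta) ^+ k.
  move=> kK; have K0 : 0 < (2 * K.+1)%:R :> R by rewrite ltr0n.
  have eta1 : eta <= 1 by rewrite invf_le1 // ler1n.
  apply: le_trans (bernoulli k (_ : -1 <= - eta)); last lra.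
  have : k%:R * eta <= 2^-1.
    rewrite ler_pdivrMr // natrM mulrA mulVf ?mul1r ?ler_nat ?pnatr_eq0 //; exact: ltnW.
  lra.
have eta1 : 0 < 1 - eta.
  rewrite subr_gt0 invf_lt1 ?ltr0n // ltr1n; lia.
pose x := th * (1 - eta).
have x0 : 0 < x by rewrite mulr_gt0.
have xth : x < th by rewrite /x -[ltRHS]mulr1 ltr_pM2l //; lra.
have weight k : (k <= K)%N -> th ^+ k / 2 <= x ^+ k.
  by move=> kK; rewrite exprMn ler_wpM2l ?etaK // exprn_ge0 // ltW.
have big : (size s)%:R <= x ^+ l g * \sum_(a <- A) x ^+ l a.
  apply: le_trans (_ : (th ^+ l g / 2) * (\sum_(a <- A) th ^+ l a / 2) <= _).
    by rewrite -mulr_suml; lra.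
  apply: ler_pM.
  - by rewrite divr_ge0 // exprn_ge0 // ltW.
  - by rewrite sumr_ge0 // => a _; rewrite divr_ge0 // exprn_ge0 // ltW.
  - by apply: weight; rewrite /K leq_addl.
  rewrite big_seq [leRHS]big_seq; apply: ler_sum => a /lA la.
  by apply: weight; rewrite /K; lia.
have mass k := @words_weight s A x k sP uA AP (ltac:(lra)) big.
rewrite ltNge; apply/negP => rate.
have ltx : (exp_rate R (cnt l setT) < (x^-1)%:E)%E.
  by apply: le_lt_trans rate _; rewrite lte_fin -[lam]invrK ltf_pV2 ?posrE.
have [rho [n0 [rho0 rhox hrho]]] := exp_rate_lt ltx.
pose t := rho * x; have t01 : 0 <= t < 1.
  rewrite mulr_ge0 ?(ltW x0) //=; rewrite -ltr_pdivlMr // div1r //.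
have [/andP[t0 t1]] := t01.
have eps0 : 0 < (1 - t) * x ^+ l g by rewrite mulr_gt0 ?exprn_gt0 // subr_gt0.
have [n1 hn1] := expr_lt_eps t01 eps0.
pose N := maxn n0.+1 n1.
have [k0 hk0] := bounded_on_finite len (lfin N).
have [uV VP] := wordsP k0.+1 AP.
pose M := (\max_(y <- words A k0.+1) l y).+1.
have VN z : z \in words A k0.+1 -> (N <= l z < M)%N.
  move=> zV; rewrite ltnS leq_bigmax_seq // andbT ltnW // ltnNge; apply/negP => lz.
  by have [_] := VP z zV; rewrite ltnNge hk0.
have := weight_tail_le uV (ltW x0) VN.
set Sx := (X in _ <= X) => hS.
have St : Sx <= \sum_(N <= k < M) t ^+ k.
  rewrite /Sx big_nat [leRHS]big_nat; apply: ler_sum => k /andP[Nk _].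
  rewrite (exprMn k rho x) ler_wpM2r ?exprn_ge0 ?(ltW x0) // hrho //.
  by apply: leq_trans Nk; rewrite leq_max leqnn.
have geo := @geometric_le R t N M (ltac:(lra)).
have := hn1 N (leq_maxr _ _); have := mass k0.+1.
have : (1 - t) * Sx <= (1 - t) * \sum_(N <= k < M) t ^+ k.
  by rewrite ler_pM2l ?subr_gt0.
have : (1 - t) * x ^+ l g <= (1 - t) * Sx.
  by rewrite ler_pM2l ?subr_gt0 // (le_trans (mass k0.+1)).
lra.
Qed.
End CodedGrowth.

(** * The strict inequality *)

Lemma generated_axis (G : groupType) (v h : G) : generated [set v] h ->
  exists b i, h = axis v b i.
Proof.
move=> gh; apply: (gh [set h | exists b i, h = axis v b i]); split; last first.
  by move=> _ ->; exists true, 1%N.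
split=> [|x y]; rewrite !inE; first by exists true, 0%N.
move=> [b [i ->]] [b' [j ->]]; rewrite axisV.
have [->|bb'] := eqVneq b (~~ b'); first by exists (~~ b'), (i + j)%N; rewrite axisD.
have {bb'} -> : ~~ b' = ~~ b by case: b b' bb' => [] [].
have [ij|ji] := leqP i j.
  by exists (~~ b), (j - i)%N; rewrite -(axis_sub _ _ ij) axisV negbK.
exists b, (i - j)%N; rewrite -{1}(subnK (ltnW ji)) axisD -mulgA.
by rewrite -{2}(negbK b) -axisV mulVg mulg1.
Qed.

Section StrictInequality.
Variables (R : realType) (G : groupType) (X : graph) (a : graph_action G X) (b : X).
Hypothesis conn : connected_graph X.
Hypothesis proper : proper_action a.
Hypothesis cocpt : cocompact_action a.
Variables (S : set G) (e : nat).
Hypothesis genS : finite_generating_set S.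
Hypothesis hlen : hyperbolic_length (word_len S) e.
Hypothesis nel : ~ elementary_group G.
Notation d := (fun x y : G => word_len S (x^-1 * y)%g).

Lemma infinite_growth_lt (H : set G) K : is_subgroup H ->
  (forall h z, H h -> between d 1%g z h -> exists2 h', H h' & (d z h' <= K)%N) ->
  ~ finite_index H -> infinite_set H ->
  (growth_rate a R b H < growth_rate a R b setT)%E.
Proof.
move=> sH qH nfi Hinf; rewrite -[growth_rate a R b H]/(exp_rate R (cnt (orbit_len a b) H)).
rewrite -[growth_rate a R b setT]/(exp_rate R (cnt (orbit_len a b) setT)).
have lfin : forall r, finite_set [set g | (orbit_len a b g <= r)%N] := proper b.
have l1 := orbit_len1 a b conn; have lM := orbit_lenM a b conn.
have [C split] := split_quasiconvex b conn cocpt proper genS hlen (subgroup1 sH) qH.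
have [lam [lam1 rate lamX]] := @submultiplicative_rate R _ _
  (cnt_gt0 lfin sH l1) (@cnt_mono _ _ lfin H) (cnt_submultiplicative lfin sH l1 split).
have [D [L [g [W [Wg Wstep Wcode]]]]] := coded_products hlen sH qH nel nfi.
apply: le_lt_trans rate _.
apply: (@coded_growth _ _ _ _ lfin lM hlen H D L g W) => //.
exact: poincare_diverges lamX.
Qed.

(** A finite H grows no faster than the infinite subgroup generated by v, to which
    the infinite case applies. *)
Lemma growth_lt (H : set G) : quasiconvex_subgroup H -> ~ finite_index H ->
  (growth_rate a R b H < growth_rate a R b setT)%E.
Proof.
move=> qH nfi; have [K hK] := quasiconvex_word_metric genS hlen qH.
have [Hfin|Hinf] := pselect (finite_set H); last exact: infinite_growth_lt qH.1 hK nfi Hinf.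
have lfin : forall r, finite_set [set g | (orbit_len a b g <= r)%N] := proper b.
have [v [v0 lv nfiv]] := nonelementary_axis hlen nel.
pose Q := generated [set v].
have Qinf : infinite_set Q.
  move=> /(bounded_on_finite (word_len S))[D hD].
  have := hD (axis v true D.+1) (@axis_generated _ v true D.+1).
  by rewrite (len_axis hlen lv) leqNgt (leq_pmulr D.+1 v0).
apply: le_lt_trans (_ : (growth_rate a R b Q < _)%E); last first.
  apply: (@infinite_growth_lt Q (word_len S v + e)) => //.
    exact: generated_subgroup.
  move=> h z /generated_axis[c [i ->]] zb.
  have [|c' [j hj]] := near_axis hlen v0 lv
    (_ : between d (axis v (~~ c) 0) z (axis v (~~ ~~ c) i)).
    by rewrite negbK axis0.
  by exists (axis v c' j) => //; exact: axis_generated.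
rewrite -[growth_rate a R b H]/(exp_rate R (cnt (orbit_len a b) H)).
rewrite -[growth_rate a R b Q]/(exp_rate R (cnt (orbit_len a b) Q)).
have /finite_seqP[s sE] := Hfin.
have [A AQ sA] := infinite_set_fset (size s) Qinf.
apply: (@le_exp_rate _ _ _ (\max_(h <- A) orbit_len a b h)) => n hn.
apply: leq_trans (_ : (size s <= _)%N).
  by apply: cnt_le => // h Hh _; rewrite sE in Hh.
apply: leq_trans sA _; apply: cnt_ge => //; first exact: fset_uniq.
move=> h hA; split; first exact: AQ.
by apply: leq_trans hn; exact: leq_bigmax_seq.
Qed.
End StrictInequality.

Theorem theorem1p1 (R : realType) (G : groupType) (X : graph)
    (a : graph_action G X) (H : set G) (b : X) :
  hyperbolic_group G R -> ~ elementary_group G ->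
  connected_graph X -> proper_action a -> cocompact_action a ->
  quasiconvex_subgroup H -> ~ finite_index H ->
  (growth_rate a R b H < growth_rate a R b [set: G])%E.
Proof.
move=> [S genS hypS] nel conn proper cocpt qH nfi.
have [e hlen] := word_hyperbolic genS.2 genS.1 hypS.
exact: (growth_lt R b conn proper cocpt genS hlen nel qH nfi).
Qed.
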